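(* Let $(\mathbb{K},|\cdot|)$ be either $\mathbb{R}$ with its usual absolute value, or an ultrametric field. Let $E$ and $F$ be (Hausdorff) topological $\mathbb{K}$-vector spaces and let $f\colon U\to F$ be a map defined on a non-empty open subset $U\subseteq E$. Assume $E$ is metrizable. Then for each $k\in\mathbb{N}_0$ the following are equivalent: (a) $f$ is of class $C^k_{\mathbb{K}}$; (b) for every smooth map $c\colon\mathbb{K}^{k+1}\to E$ with image in $U$, the composition $f\circ c\colon\mathbb{K}^{k+1}\to F$ is of class $C^k_{\mathbb{K}}$. In particular, $f$ is smooth if and only if $f\circ c$ is smooth for every $k\in\mathbb{N}$ and every smooth map $c\colon\mathbb{K}^k\to E$ with image in $U$.
   Context: An ultrametric field is a field $\mathbb{K}$ with a non-trivial absolute value $|\cdot|\colon\mathbb{K}\to[0,\infty[$ satisfying $|x+y|\le\max\{|x|,|y|\}$, with the induced topology. All topological vector spaces are Hausdorff; products carry the product topology. Differential calculus: for a topological $\mathbb{K}$-vector space $E$ and open $U\subseteq E$, set $U^{[1]}:=\{(x,v,t)\in U\times E\times\mathbb{K}: x+tv\in U\}$, an open subset of $E\times E\times\mathbb{K}$. A map $f\colon U\to F$ into a topological $\mathbb{K}$-vector space $F$ is of class $C^0$ if it is continuous, and of class $C^1$ if it is continuous and there is a continuous map $f^{[1]}\colon U^{[1]}\to F$ with $f(x+tv)-f(x)=t\,f^{[1]}(x,v,t)$ for all $(x,v,t)\in U^{[1]}$ (such $f^{[1]}$ is unique). Recursively, $U^{[k+1]}:=(U^{[k]})^{[1]}$,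 and $f$ is of class $C^{k+1}$ if it is $C^k$ and $f^{[k]}\colon U^{[k]}\to F$ is $C^1$, with $f^{[k+1]}:=(f^{[k]})^{[1]}$. The map $f$ is smooth ($C^\infty$) if it is $C^k$ for all $k\in\mathbb{N}_0$. $\mathbb{N}=\{1,2,\dots\}$. *)

(* Defs.v *)
From HB Require Import structures.
From mathcomp Require Import all_boot all_order all_algebra.
From mathcomp Require Import Rstruct.
Import Order.TTheory GRing.Theory Num.Theory.
Local Open Scope ring_scope.

Notation RR := Rdefinitions.R.

Definition abs_value {K : fieldType} (abs : K -> RR) : Prop :=
  (forall x, 0 <= abs x) /\ (forall x, abs x = 0 <-> x = 0) /\
  (forall x y, abs (x * y) = abs x * abs y) /\
  (forall x y, abs (x + y) <= abs x + abs y).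

Definition nontrivial_abs {K : fieldType} (abs : K -> RR) : Prop :=
  exists x, abs x <> 0 /\ abs x <> 1.

Definition ultrametric {K : fieldType} (abs : K -> RR) : Prop :=
  forall x y, abs (x + y) <= Num.max (abs x) (abs y).

Definition real_valued {K : fieldType} (abs : K -> RR) : Prop :=
  exists phi : K -> RR, bijective phi /\
    (forall x y, phi (x + y) = phi x + phi y) /\
    (forall x y, phi (x * y) = phi x * phi y) /\ phi 1 = 1 /\
    (forall x, abs x = `|phi x|).

Definition Kopen {K : fieldType} (abs : K -> RR) (A : K -> Prop) : Prop :=
  forall x, A x -> exists e : RR, 0 < e /\ forall y, abs (y - x) < e -> A y.

Definition prod_op {X Y : Type} (opX : (X -> Prop) -> Prop) (opY : (Y -> Prop) -> Prop)
  (A : X * Y -> Prop) : Prop :=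
  forall p, A p -> exists V W, opX V /\ opY W /\ V p.1 /\ W p.2 /\
    forall q, V q.1 -> W q.2 -> A q.

Definition is_topology {X : Type} (kop : (X -> Prop) -> Prop) : Prop :=
  kop (fun _ => True) /\
  (forall (I : Type) (A : I -> X -> Prop), (forall i, kop (A i)) ->
      kop (fun x => exists i, A i x)) /\
  (forall A B, kop A -> kop B -> kop (fun x => A x /\ B x)).

Definition hausdorff {X : Type} (kop : (X -> Prop) -> Prop) : Prop :=
  forall x y, x <> y -> exists V W, kop V /\ kop W /\ V x /\ W y /\
    forall z, V z -> W z -> False.

Definition cont_on {X Y : Type} (opX : (X -> Prop) -> Prop) (opY : (Y -> Prop) -> Prop)
  (D : X -> Prop) (g : X -> Y) : Prop :=
  forall x, D x -> forall W, opY W -> W (g x) ->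
    exists V, opX V /\ V x /\ forall y, V y -> D y -> W (g y).

Record kspace (K : fieldType) := KSpace { kcar : lmodType K; kop : (kcar -> Prop) -> Prop }.
Arguments KSpace {K} kcar kop.
Arguments kcar {K} k.
Arguments kop {K} k _.

Definition is_tvs {K : fieldType} (abs : K -> RR) (S : kspace K) : Prop :=
  is_topology (kop S) /\ hausdorff (kop S) /\
  cont_on (prod_op (kop S) (kop S)) (kop S) (fun _ => True)
          (fun p : kcar S * kcar S => p.1 + p.2) /\
  cont_on (prod_op (Kopen abs) (kop S)) (kop S) (fun _ => True)
          (fun p : K * kcar S => p.1 *: p.2).

Definition metrizable {K : fieldType} (S : kspace K) : Prop :=
  exists d : kcar S -> kcar S -> RR,
    (forall x y, 0 <= d x y) /\ (forall x y, d x y = 0 <-> x = y) /\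
    (forall x y, d x y = d y x) /\ (forall x y z, d x z <= d x y + d y z) /\
    (forall A, kop S A <-> forall x, A x -> exists e : RR, 0 < e /\
                                      forall y, d x y < e -> A y).

Definition Kn {K : fieldType} (abs : K -> RR) (n : nat) : kspace K :=
  KSpace 'rV[K]_n (fun A => forall p, A p -> exists e : RR, 0 < e /\
      forall q : 'rV[K]_n, (forall i, abs (q ord0 i - p ord0 i) < e) -> A q).

Definition sp1 {K : fieldType} (abs : K -> RR) (S : kspace K) : kspace K :=
  KSpace (kcar S * kcar S * K^o)%type
    (prod_op (prod_op (kop S) (kop S)) (Kopen abs)).

Definition spk {K : fieldType} (abs : K -> RR) (S : kspace K) (k : nat) : kspace K :=
  iter k (sp1 abs) S.

Definition U1 {K : fieldType} (abs : K -> RR) (S : kspace K) (U : kcar S -> Prop)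
  : kcar (sp1 abs S) -> Prop :=
  fun p => U p.1.1 /\ U (p.1.1 + (p.2 : K) *: p.1.2).

Fixpoint Uk {K : fieldType} (abs : K -> RR) (S : kspace K) (U : kcar S -> Prop) (k : nat)
  : kcar (spk abs S k) -> Prop :=
  match k as k0 return kcar (spk abs S k0) -> Prop with
  | 0 => U
  | k'.+1 => U1 abs (spk abs S k') (Uk abs S U k')
  end.

Definition diff1 {K : fieldType} (abs : K -> RR) (S F : kspace K) (U : kcar S -> Prop)
  (f : kcar S -> kcar F) (f1 : kcar (sp1 abs S) -> kcar F) : Prop :=
  cont_on (kop (sp1 abs S)) (kop F) (U1 abs S U) f1 /\
  forall p, U1 abs S U p -> f (p.1.1 + (p.2 : K) *: p.1.2) - f p.1.1 = (p.2 : K) *: f1 p.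

(* is_fk k f g : f is C^k on U and g = f^[k] *)
Fixpoint is_fk {K : fieldType} (abs : K -> RR) (S F : kspace K) (U : kcar S -> Prop)
  (k : nat) (f : kcar S -> kcar F) : (kcar (spk abs S k) -> kcar F) -> Prop :=
  match k as k0 return (kcar (spk abs S k0) -> kcar F) -> Prop with
  | 0 => fun g => g = f /\ cont_on (kop S) (kop F) U f
  | k'.+1 => fun h => exists g : kcar (spk abs S k') -> kcar F,
      is_fk abs S F U k' f g /\
      cont_on (kop (spk abs S k')) (kop F) (Uk abs S U k') g /\
      diff1 abs (spk abs S k') F (Uk abs S U k') g h
  end.

Definition Ck {K : fieldType} (abs : K -> RR) (S F : kspace K) (U : kcar S -> Prop)
  (k : nat) (f : kcar S -> kcar F) : Prop :=
  exists g, is_fk abs S F U k f g.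

Definition smooth {K : fieldType} (abs : K -> RR) (S F : kspace K) (U : kcar S -> Prop)
  (f : kcar S -> kcar F) : Prop :=
  forall k, Ck abs S F U k f.

(* Main.v *)
(** One direction is the chain rule.  For the converse, induct on [k].

    For [k = 0], suppose [f] is discontinuous at [x].  As [E] is first countable, there are
    points [y_n] tending to [x] as fast as we like with [f y_n] away from [f x].  A smooth
    curve [c] with [c (a^n) = y_n] and [c 0 = x] is obtained as
    [x + sum_n kappa_n(t) (y_n - x)] with disjointly supported bump functions [kappa_n]; it is
    smooth at [0] because all difference quotients of a bump are bounded on bounded sets, at
    most [2^k] terms of the series of [k]-fold quotients are non-zero at any point, and
    [y_n - x] is small enough to beat the bounds.  Then [f o c] is discontinuous.

    For the step, the partial difference quotient map [f1] of [f] on [U^[1]] satisfies the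
    hypothesis for [k]: given a smooth [(X, V, T) : K^(k+1) -> U^[1]], locally either [T] is
    invertible and [f1] is an honest quotient, or [T] is close to [0] and [f1 o (X, V, T)]
    is read off the difference quotient of [f o c] for
    [c(s, tau) = X(s) + tau V(s)] (with [s], [tau] cut off), a map of [k + 2] variables.

    Bump functions come from the indicator of a ball in the ultrametric case, and from
    [exp(-1/t)] in the real case. *)

(* Neither [E] nor [F] is assumed complete or locally convex, so convergent series and integrals of
   vectors are out of reach. Every series is therefore finite at each point, and its tail is
   controlled by the number of its non-zero terms: a sum of at most [N] vectors from a small enough
   neighbourhood of [0] stays in a given one. Integrals are taken of scalar functions only, to pass
   from derivatives of the real bump to its difference quotients. A second obstacle is that [K] need
   not be locally compact, so that continuity yields no bounds on balls. Boundedness on sets of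
   bounded size is carried through the whole calculus instead, next to continuity. Finally, test
   maps live on all of [K^(k+1)] and must take values in [U]. A local question about the quotient of
   [f] has to be answered by a global map, which is the reason for cutting off parameters. *)
Require Import Defs.
From Stdlib Require Import Reals Lra.
From Coquelicot Require Import Coquelicot.

(** * The flat function, means over the unit interval, and compactness of that interval *)

Section RealAnalysis.
Local Open Scope R_scope.

(* The point of the exponent [m] is that the family is closed under differentiation. *)
Definition flat (m : nat) (t : R) : R :=
  if Rle_dec t 0 then 0 else exp (- / t) * (/ t) ^ m.

Lemma flat_neg m t : t <= 0 -> flat m t = 0.
Proof. intros H; unfold flat; destruct (Rle_dec t 0); [reflexivity|contradiction]. Qed.

Lemma flat_pos m t : 0 < t -> flat m t = exp (- / t) * (/ t) ^ m.
Proof. intros H; unfold flat; destruct (Rle_dec t 0); [lra|reflexivity]. Qed.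

Lemma flat_ge0 m t : 0 <= flat m t.
Proof.
destruct (Rle_or_lt t 0) as [H|H]; [rewrite flat_neg; lra|rewrite flat_pos; trivial].
apply Rmult_le_pos; [left; apply exp_pos|apply pow_le; left; now apply Rinv_0_lt_compat].
Qed.

Lemma exp_pow n u : exp (INR n * u) = exp u ^ n.
Proof.
induction n as [|n IH]; [rewrite Rmult_0_l; apply exp_0|].
rewrite S_INR, Rmult_plus_distr_r, exp_plus, IH, Rmult_1_l; simpl; ring.
Qed.

(** With [u = / t] the claim reads [u^m <= (m+1)^m exp u]; it is the [m]-th power of
    [u/(m+1) <= exp (u/(m+1))]. Dividing by [m + 1] rather than [m] covers [m = 0] as well. *)
Lemma flat_bound m : exists M, forall t, Rabs (flat m t) <= M.
Proof.
exists (INR (S m) ^ m); intros t; rewrite Rabs_pos_eq by apply flat_ge0.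
assert (Hm : 0 < INR (S m)) by (apply lt_0_INR; apply Nat.lt_0_succ).
destruct (Rle_or_lt t 0) as [H|H]; [rewrite flat_neg by trivial; apply pow_le; lra|].
rewrite flat_pos by trivial; set (u := / t).
assert (Hu : 0 < u) by now apply Rinv_0_lt_compat.
assert (H1 : (u / INR (S m)) ^ m <= exp u).
{ apply Rle_trans with (exp (INR m * (u / INR (S m)))).
  - rewrite exp_pow; apply pow_incr; split.
    + left; now apply Rdiv_lt_0_compat.
    + pose proof (exp_ineq1_le (u / INR (S m))); lra.
  - assert (INR m * (u / INR (S m)) <= u).
    { apply Rmult_le_reg_r with (INR (S m)); trivial.
      replace (INR m * (u / INR (S m)) * INR (S m)) with (u * INR m) by (field; lra).
      apply Rmult_le_compat_l; [lra|]. rewrite S_INR; lra. }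
    destruct (Rle_lt_or_eq_dec _ _ H0) as [h|h]; [left; now apply exp_increasing|rewrite h; lra]. }
unfold Rdiv in H1; rewrite Rpow_mult_distr, pow_inv in H1.
rewrite exp_Ropp.
assert (He := exp_pos u).
apply Rmult_le_reg_l with (exp u); trivial.
replace (exp u * (/ exp u * u ^ m)) with (u ^ m) by (field; lra).
assert (Hp : 0 < INR (S m) ^ m) by now apply pow_lt.
apply Rmult_le_reg_r with (/ INR (S m) ^ m); [now apply Rinv_0_lt_compat|].
rewrite Rmult_assoc, Rinv_r, Rmult_1_r by lra; exact H1.
Qed.

Lemma flat_step m t : flat m t = t * flat (S m) t.
Proof.
destruct (Rle_or_lt t 0) as [H|H]; [rewrite !flat_neg by trivial; ring|].
rewrite !flat_pos by trivial; simpl; field; lra.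
Qed.

Lemma flat_derive m t :
  is_derive (flat m) t (flat (S (S m)) t - INR m * flat (S m) t).
Proof.
destruct (Rtotal_order t 0) as [H|[H|H]].
- rewrite !flat_neg by lra; replace (0 - INR m * 0) with 0 by ring.
  apply is_derive_ext_loc with (fun _ => 0); [|apply @is_derive_const].
  exists (mkposreal (- t) (Ropp_0_gt_lt_contravar _ H)); intros y Hy.
  unfold ball in Hy; simpl in Hy; unfold AbsRing_ball, abs, minus, plus, opp in Hy; simpl in Hy.
  rewrite flat_neg; trivial; apply Rabs_def2 in Hy; lra.
- subst t; rewrite !flat_neg by lra; replace (0 - INR m * 0) with 0 by ring.
  apply is_derive_Reals; intros eps Heps.
  destruct (flat_bound (S (S m))) as [M HM].
  assert (HM0 : 0 <= M) by (apply Rle_trans with (1 := Rabs_pos _) (2 := HM 0)).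
  assert (Hd : 0 < eps / (M + 1)) by (apply Rdiv_lt_0_compat; lra).
  exists (mkposreal _ Hd); intros h h0 Hh; simpl in Hh.
  rewrite Rplus_0_l, (flat_neg m 0), !Rminus_0_r by lra.
  (* Extracting two factors [h] turns the quotient into [h * flat (S (S m)) h], at most [M |h|]. The
     [M + 1] in the radius allows for [M = 0]. *)
  rewrite flat_step, flat_step.
  replace (h * (h * flat (S (S m)) h) / h) with (h * flat (S (S m)) h) by (field; trivial).
  rewrite Rabs_mult.
  apply Rle_lt_trans with (Rabs h * M); [apply Rmult_le_compat_l; [apply Rabs_pos|apply HM]|].
  apply Rlt_le_trans with (eps / (M + 1) * (M + 1)); [|right; field; lra].
  assert (0 <= Rabs h) by apply Rabs_pos.
  apply Rle_lt_trans with (Rabs h * (M + 1)); [apply Rmult_le_compat_l; lra|].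
  apply Rmult_lt_compat_r; lra.
- apply is_derive_ext_loc with (fun y => exp (- / y) * (/ y) ^ m).
  + exists (mkposreal t H); intros y Hy.
    unfold ball in Hy; simpl in Hy; unfold AbsRing_ball, abs, minus, plus, opp in Hy; simpl in Hy.
    rewrite flat_pos; trivial; apply Rabs_def2 in Hy; lra.
  + rewrite !flat_pos by trivial; auto_derive; [repeat split; lra|].
    destruct m as [|m]; [simpl; field; lra|].
    change (pred (S m)) with m; cbn [pow]; field; lra.
Qed.

Lemma flat0_incr s t : s <= t -> flat 0 s <= flat 0 t.
Proof.
intros H; destruct (Rle_or_lt s 0) as [Hs|Hs]; [rewrite flat_neg by trivial; apply flat_ge0|].
rewrite !flat_pos by lra; simpl; rewrite !Rmult_1_r.
destruct H as [H|H]; [|rewrite H; lra].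
left; apply exp_increasing; apply Ropp_lt_contravar; apply Rinv_lt_contravar; trivial.
apply Rmult_lt_0_compat; lra.
Qed.

(** Nesting [flat 0] in itself replaces the usual quotient of two flat functions: the only division
    is by a constant, so compositions, differences and products suffice to show smoothness with
    bounds. *)
Definition smooth_step (t : R) : R :=
  / flat 0 (flat 0 1) * flat 0 (flat 0 1 - flat 0 t).

Lemma flat01_pos : 0 < flat 0 (flat 0 1).
Proof.
assert (0 < flat 0 1) by (rewrite flat_pos by lra; simpl; rewrite Rmult_1_r; apply exp_pos).
rewrite flat_pos by trivial; simpl; rewrite Rmult_1_r; apply exp_pos.
Qed.

Lemma smooth_step_bound t : Rabs (smooth_step t) <= 1.
Proof.
pose proof flat01_pos as H; unfold smooth_step.
rewrite Rabs_pos_eq.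
- apply Rmult_le_reg_l with (flat 0 (flat 0 1)); trivial.
  rewrite <- Rmult_assoc, Rinv_r, Rmult_1_l, Rmult_1_r by lra.
  apply flat0_incr; pose proof (flat_ge0 0 t); lra.
- apply Rmult_le_pos; [left; now apply Rinv_0_lt_compat|apply flat_ge0].
Qed.

Lemma smooth_step1 t : t <= 0 -> smooth_step t = 1.
Proof.
intros Ht; pose proof flat01_pos as H; unfold smooth_step.
rewrite (flat_neg 0 t), Rminus_0_r by trivial; field; lra.
Qed.

Lemma smooth_step0 t : 1 <= t -> smooth_step t = 0.
Proof.
intros Ht; unfold smooth_step; rewrite (flat_neg 0 (flat 0 1 - flat 0 t)); [ring|].
pose proof (flat0_incr 1 t Ht); lra.
Qed.

(** Serves to write a difference quotient as the mean of a derivative along a segment. *)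
Definition avg (h : R -> R) : R := RInt h 0 1.

Definition econt (h : R -> R) : Prop := forall s eps, 0 < eps ->
  exists d, 0 < d /\ forall s', Rabs (s' - s) < d -> Rabs (h s' - h s) < eps.

Lemma econt_continuous h s : econt h -> continuous h s.
Proof.
intros H; apply continuity_pt_filterlim; intros eps Heps.
destruct (H s eps Heps) as [d [Hd Hh]]; exists d; split; trivial.
intros y [_ Hy]; apply Hh; exact Hy.
Qed.

Lemma econt_ex_RInt h : econt h -> ex_RInt h 0 1.
Proof. intros H; apply (ex_RInt_continuous (V := R_CompleteNormedModule)); intros; now apply econt_continuous. Qed.

Lemma avg_minus h g : econt h -> econt g -> avg (fun s => h s - g s) = avg h - avg g.
Proof.
intros Hh Hg; unfold avg.
exact (RInt_minus (V := R_CompleteNormedModule) h g 0 1 (econt_ex_RInt h Hh) (econt_ex_RInt g Hg)).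
Qed.

Lemma avg_scal c h : econt h -> avg (fun s => c * h s) = c * avg h.
Proof.
intros Hh; unfold avg.
exact (RInt_scal (V := R_CompleteNormedModule) h 0 1 c (econt_ex_RInt h Hh)).
Qed.

Lemma avg_ext h g : (forall s, h s = g s) -> avg h = avg g.
Proof. intros H; apply RInt_ext; intros; apply H. Qed.

Lemma avg_bound h M : econt h -> (forall s, 0 <= s <= 1 -> Rabs (h s) <= M) -> Rabs (avg h) <= M.
Proof.
intros Hh HM; replace M with ((1 - 0) * M) by ring.
apply (abs_RInt_le_const h 0 1 M); [lra|now apply econt_ex_RInt|exact HM].
Qed.

Lemma avg_derive f h : econt h -> (forall s, is_derive f s (h s)) -> avg h = f 1 - f 0.
Proof.
intros Hh Hf; apply is_RInt_unique; apply (is_RInt_derive f h 0 1).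
- intros; apply Hf.
- intros; now apply econt_continuous.
Qed.

(** Tube lemma for the compact interval [[0,1]] and an arbitrary space of parameters. [E] collects
    the [s] for which one [V] serves all of [[0,s]]; a neighbourhood of its supremum extends it
    further unless the supremum is already [1]. *)
Lemma tube {X : Type} (opX : (X -> Prop) -> Prop) (P : R -> X -> Prop) (y0 : X) :
  (forall A B, opX A -> opX B -> opX (fun x => A x /\ B x)) ->
  (forall s, 0 <= s <= 1 -> exists d V, 0 < d /\ opX V /\ V y0 /\
     forall s' y, Rabs (s' - s) < d -> V y -> P s' y) ->
  exists V, opX V /\ V y0 /\ forall s y, 0 <= s <= 1 -> V y -> P s y.
Proof.
intros topI H.
pose (E := fun s => 0 <= s <= 1 /\ exists V, opX V /\ V y0 /\
  forall s' y, 0 <= s' <= s -> V y -> P s' y).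
assert (E0 : E 0).
{ split; [lra|]; destruct (H 0) as [d [V [Hd [oV [V0 HV]]]]]; [lra|].
  exists V; split; [trivial|split; trivial]; intros s' y Hs Vy; apply HV; trivial.
  replace s' with 0 by lra; rewrite Rminus_0_r, Rabs_R0; trivial. }
destruct (completeness E) as [m [Hub Hlub]].
- exists 1; intros s [Hs _]; lra.
- exists 0; trivial.
- assert (Hm : 0 <= m <= 1).
  { split; [now apply Hub|apply Hlub; intros s [Hs _]; lra]. }
  destruct (H m Hm) as [d [V [Hd [oV [V0 HV]]]]].
  assert (Hs : exists s, E s /\ m - d < s).
  { apply Classical_Prop.NNPP; intros C.
    assert (m <= m - d); [|lra].
    apply Hlub; intros s Es; apply Rnot_lt_le; intros Hs; apply C; exists s; now split. }
  destruct Hs as [s [[Hs [V' [oV' [V0' HV']]]] Hsm]].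
  assert (Esm : E (Rmin 1 (m + d / 2))).
  { split; [split; [apply Rmin_glb; lra|apply Rmin_l]|].
    exists (fun y => V y /\ V' y); split; [now apply topI|split; [now split|]].
    intros s' y Hs' [Vy Vy']; destruct (Rle_or_lt s' s) as [h|h]; [apply HV'; trivial; lra|].
    apply HV; trivial; apply Rabs_def1; [|lra].
    assert (Rmin 1 (m + d / 2) <= m + d / 2) by apply Rmin_r; lra. }
  assert (Hle := Hub _ Esm).
  assert (Hm1 : Rmin 1 (m + d / 2) = 1).
  { unfold Rmin in *; destruct (Rle_dec 1 (m + d / 2)); [reflexivity|lra]. }
  rewrite Hm1 in Esm; destruct Esm as [_ [V2 [oV2 [V02 HV2]]]].
  exists V2; split; [trivial|split; [trivial|]]; intros; now apply HV2.
Qed.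

End RealAnalysis.

From HB Require Import structures.
From mathcomp Require Import all_boot all_order all_algebra.
From mathcomp Require Import boolp Rstruct ring lra.
Import Order.TTheory GRing.Theory Num.Theory.
Local Open Scope ring_scope.

Definition wholeset {X : Type} : X -> Prop := fun _ => True.

Set Implicit Arguments.
Unset Strict Implicit.
Unset Printing Implicit Defensive.

(** * Continuity on subsets, products, and local criteria for openness *)

Section Continuity.
Context {X Y Z : Type} (opX : (X -> Prop) -> Prop) (opY : (Y -> Prop) -> Prop)
  (opZ : (Z -> Prop) -> Prop).

Lemma cont_on_sub (D D' : X -> Prop) (g : X -> Y) :
  (forall x, D' x -> D x) -> cont_on opX opY D g -> cont_on opX opY D' g.
Proof.
move=> sub cg x Dx W oW Wx; have [V [oV [Vx H]]] := cg x (sub _ Dx) W oW Wx.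
by exists V; split=> //; split=> // y Vy /sub; apply: H.
Qed.

Lemma cont_on_ext (D : X -> Prop) (g h : X -> Y) :
  (forall x, D x -> g x = h x) -> cont_on opX opY D g -> cont_on opX opY D h.
Proof.
move=> eq cg x Dx W oW; rewrite -eq // => Wx; have [V [oV [Vx H]]] := cg x Dx W oW Wx.
by exists V; split=> //; split=> // y Vy Dy; rewrite -eq //; apply: H.
Qed.

Lemma cont_on_comp (D : X -> Prop) (D' : Y -> Prop) (g : X -> Y) (h : Y -> Z) :
  (forall x, D x -> D' (g x)) -> cont_on opX opY D g -> cont_on opY opZ D' h ->
  cont_on opX opZ D (h \o g).
Proof.
move=> DD' cg ch x Dx W oW Wx.
have [V [oV [Vx HV]]] := ch _ (DD' _ Dx) W oW Wx.
have [T [oT [Tx HT]]] := cg x Dx V oV Vx.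
by exists T; split=> //; split=> // y Ty Dy; apply: HV; [apply: HT|apply: DD'].
Qed.

Lemma cont_on_pair (D : X -> Prop) (g : X -> Y) (h : X -> Z) :
  is_topology opX -> cont_on opX opY D g -> cont_on opX opZ D h ->
  cont_on opX (prod_op opY opZ) D (fun x => (g x, h x)).
Proof.
move=> [_ [_ topI]] cg ch x Dx W oW Wx.
have [A [B [oA [oB [/= Ax [Bx HAB]]]]]] := oW _ Wx.
have [V [oV [Vx HV]]] := cg x Dx A oA Ax.
have [T [oT [Tx HT]]] := ch x Dx B oB Bx.
exists (fun x => V x /\ T x); split; first exact: topI.
by split=> // y [Vy Ty] Dy; apply: HAB => /=; [apply: HV|apply: HT].
Qed.

Lemma cont_on_fst (D : X * Y -> Prop) : is_topology opY ->
  cont_on (prod_op opX opY) opX D fst.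
Proof.
move=> [topT _] p Dp W oW Wp; exists (fun q => W q.1); split; last by split.
by move=> q Wq; exists W, (fun _ => True); do !split.
Qed.

Lemma cont_on_snd (D : X * Y -> Prop) : is_topology opX ->
  cont_on (prod_op opX opY) opY D snd.
Proof.
move=> [topT _] p Dp W oW Wp; exists (fun q => W q.2); split; last by split.
by move=> q Wq; exists (fun _ => True), W; do !split.
Qed.

Lemma cont_on_cst (D : X -> Prop) (c : Y) : is_topology opX ->
  cont_on opX opY D (fun _ => c).
Proof. by move=> [topT _] x Dx W oW Wx; exists (fun _ => True). Qed.

Lemma cont_on_id (D : X -> Prop) : cont_on opX opX D id.
Proof. by move=> x Dx W oW Wx; exists W. Qed.

Lemma prod_op_topology : is_topology opX -> is_topology opY ->
  is_topology (prod_op opX opY).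
Proof.
move=> [tX [uX iX]] [tY [uY iY]]; split.
  by move=> p _; exists (fun _ => True), (fun _ => True).
split.
  move=> I A oA p [i Ap]; have [V [W [oV [oW [Vp [Wp H]]]]]] := oA i p Ap.
  by exists V, W; do !split=> //; move=> q Vq Wq; exists i; apply: H.
move=> A B oA oB p [Ap Bp].
have [V [W [oV [oW [Vp [Wp H]]]]]] := oA p Ap.
have [V' [W' [oV' [oW' [Vp' [Wp' H']]]]]] := oB p Bp.
exists (fun x => V x /\ V' x), (fun x => W x /\ W' x).
split; first exact: iX.
split; first exact: iY.
by split=> //; split=> // q [? ?] [? ?]; split; [apply: H|apply: H'].
Qed.

Lemma open_of_local (A : X -> Prop) : is_topology opX ->
  (forall x, A x -> exists V, opX V /\ V x /\ forall y, V y -> A y) -> opX A.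
Proof.
move=> [_ [uX _]] H.
have -> : A = (fun x => exists i : {V : X -> Prop | opX V /\ forall y, V y -> A y}, sval i x).
  apply/funext => x; apply/propext; split.
    by move=> /H [V [oV [Vx HV]]]; exists (exist _ V (conj oV HV)).
  by move=> [[V /= [oV HV]] Vx]; apply: HV.
by apply: uX => -[V [oV HV]].
Qed.

Lemma open_preimage (g : X -> Y) (A : Y -> Prop) : is_topology opX ->
  cont_on opX opY wholeset g -> opY A -> opX (fun x => A (g x)).
Proof.
move=> tX cg oA; apply: open_of_local => // x Ax.
have [V [oV [Vx HV]]] := cg x I A oA Ax.
by exists V; split=> //; split=> // y Vy; apply: HV.
Qed.

End Continuity.

Unset Implicit Arguments.

(** * Spaces with a size function and the C^k calculus *)

(* The size of a vector bounds its scalar coordinates; requiring maps to be bounded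
   on sets of bounded size (flag [b] of [mor]) keeps track of the global estimates
   needed to sum infinitely many bump functions. *)
Record sspace (K : fieldType) := SSpace { ksp :> kspace K; sz : kcar ksp -> RR }.
Arguments SSpace {K} ksp sz.
Arguments sz {K} s x.

Definition prodS {K : fieldType} (S T : sspace K) : sspace K :=
  SSpace (KSpace (kcar S * kcar T)%type (prod_op (kop S) (kop T)))
         (fun p => Num.max (sz S p.1) (sz T p.2)).

Definition scal {K : fieldType} (abs : K -> RR) : sspace K :=
  SSpace (KSpace K^o (Kopen abs)) abs.

Definition tan {K : fieldType} (abs : K -> RR) (S : sspace K) : sspace K :=
  prodS (prodS S S) (scal abs).

Definition mor {K : fieldType} (b : bool) (S T : sspace K) (U : kcar S -> Prop)
    (f : kcar S -> kcar T) : Prop :=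
  cont_on (kop S) (kop T) U f /\
  (b -> forall R : RR, exists M : RR, forall x, U x -> sz S x <= R -> sz T (f x) <= M).

Definition quot {K : fieldType} (abs : K -> RR) (S T : kspace K) (U : kcar S -> Prop)
    (f : kcar S -> kcar T) (f1 : kcar (sp1 abs S) -> kcar T) : Prop :=
  forall p, U1 abs S U p -> f (p.1.1 + (p.2 : K) *: p.1.2) - f p.1.1 = (p.2 : K) *: f1 p.

(** The quotient is taken first and the lower class is asked of it, whereas [is_fk] peels off the
    last quotient. Recursion at this end is what inductions such as the chain rule need; [isC_Ck]
    shows that the two agree. With [b = true] every iterated quotient must also be bounded on sets
    of bounded size. *)
Fixpoint isC {K : fieldType} (abs : K -> RR) (b : bool) (k : nat) (S T : sspace K)
    (U : kcar S -> Prop) (f : kcar S -> kcar T) : Prop :=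
  mor b S T U f /\
  match k with
  | 0 => True
  | k'.+1 => exists f1 : kcar (tan abs S) -> kcar T,
      quot abs S T U f f1 /\ isC abs b k' (tan abs S) T (U1 abs S U) f1
  end.

(** The size behaves like a seminorm, which makes addition and scaling bounded morphisms. Its local
    boundedness turns estimates on sets of bounded size into estimates near each point. *)
Record wfS {K : fieldType} (abs : K -> RR) (S : sspace K) : Prop := WfS {
  wf_top : is_topology (kop S);
  wf_add : cont_on (prod_op (kop S) (kop S)) (kop S) wholeset
             (fun p : kcar S * kcar S => p.1 + p.2);
  wf_scale : cont_on (prod_op (Kopen abs) (kop S)) (kop S) wholeset
             (fun p : K * kcar S => p.1 *: p.2);
  sz_ge0 : forall x, 0 <= sz S x;
  sz_add : forall x y, sz S (x + y) <= sz S x + sz S y;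
  sz_scale : forall a x, sz S (a *: x) <= abs a * sz S x;
  sz_locb : forall x, exists V R, kop S V /\ V x /\ forall y, V y -> sz S y <= R }.

Arguments wf_top {K abs S} _.
Arguments wf_add {K abs S} _.
Arguments wf_scale {K abs S} _.
Arguments sz_ge0 {K abs S} _ x.
Arguments sz_add {K abs S} _ x y.
Arguments sz_scale {K abs S} _ a x.
Arguments sz_locb {K abs S} _ x.

Set Implicit Arguments.

(** * Absolute values, and sizes on the scalars and on products *)

Section WellFormed.
Context {K : fieldType} {abs : K -> RR} (habs : abs_value abs).

Lemma abs_ge0 x : 0 <= abs x. Proof. by case: habs. Qed.
Lemma abs_eq0 x : abs x = 0 <-> x = 0. Proof. by case: habs => _ []. Qed.
Lemma absM x y : abs (x * y) = abs x * abs y. Proof. by case: habs => _ [_ []]. Qed.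
Lemma absD x y : abs (x + y) <= abs x + abs y. Proof. by case: habs => _ [_ []]. Qed.
Lemma abs0 : abs 0 = 0. Proof. by apply/abs_eq0. Qed.
Lemma abs_gt0 x : x != 0 -> 0 < abs x.
Proof.
move=> x0; rewrite lt_neqAle abs_ge0 andbT; apply/eqP => /esym/abs_eq0/eqP.
by rewrite (negPf x0).
Qed.
Lemma abs1 : abs 1 = 1.
Proof.
have n0 : abs 1 != 0 by rewrite gt_eqF // abs_gt0 ?oner_neq0.
by apply: (mulfI n0); rewrite -absM !mulr1.
Qed.
Lemma absN1 : abs (-1) = 1.
Proof.
have : abs (-1) * abs (-1) = 1 by rewrite -absM mulrNN mulr1 abs1.
have := abs_ge0 (-1); nra.
Qed.
Lemma absN x : abs (- x) = abs x.
Proof. by rewrite -mulN1r absM absN1 mul1r. Qed.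
Lemma absB x y : abs (x - y) = abs (y - x).
Proof. by rewrite -absN opprB. Qed.
Lemma absV x : abs x^-1 = (abs x)^-1.
Proof.
have [->|x0] := eqVneq x 0; first by rewrite invr0 abs0 invr0.
have n0 : abs x != 0 by rewrite gt_eqF // abs_gt0.
by apply: (mulfI n0); rewrite -absM !divff // abs1.
Qed.
Lemma absX x n : abs (x ^+ n) = abs x ^+ n.
Proof. by elim: n => [|n IH]; rewrite ?expr0 ?abs1 // !exprS absM IH. Qed.

Lemma Kball_open (x : K) (e : RR) : Kopen abs (fun y => abs (y - x) < e).
Proof.
move=> y Hy; exists (e - abs (y - x)); split; first by rewrite subr_gt0.
move=> z Hz; have := absD (z - y) (y - x); rewrite addrA subrK; lra.
Qed.

Lemma Kopen_topology : is_topology (Kopen abs).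
Proof.
split; first by move=> x _; exists 1.
split.
  move=> I A oA x [i /oA [e [e0 H]]]; exists e; split=> // y Hy.
  by exists i; apply: H.
move=> A B oA oB x [/oA [e [e0 H]] /oB [e' [e0' H']]].
exists (Num.min e e'); split; first by rewrite lt_min e0.
by move=> y; rewrite lt_min => /andP [h h']; split; [apply: H|apply: H'].
Qed.

Lemma scal_wf : wfS abs (scal abs).
Proof.
split.
- exact: Kopen_topology.
- move=> [x y] _ W oW /= /oW [e [e0 H]].
  exists (fun q => abs (q.1 - x) < e / 2 /\ abs (q.2 - y) < e / 2); split; last split.
  + move=> q [h1 h2]; exists (fun z => abs (z - x) < e / 2), (fun z => abs (z - y) < e / 2).
    by split; [exact: Kball_open|split; [exact: Kball_open|]].
  + by rewrite /= !subrr abs0; split; lra.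
  + move=> [u v] /= [h1 h2] _; apply: H.
    have -> : u + v - (x + y) = (u - x) + (v - y) by ring.
    have := absD (u - x) (v - y); lra.
- move=> [x y] _ W oW /= /oW [e [e0 H]].
  pose M := 1 + abs x + abs y; have M1 : 1 <= M.
    by have := abs_ge0 x; have := abs_ge0 y; rewrite /M; lra.
  (* For [d <= 1] the three terms of [u v - x y] add up to at most
     [d (1 + |x| + |y|) = d * M <= e / 2]. *)
  pose d := Num.min 1 (e / (2 * M)).
  have d0 : 0 < d by rewrite lt_min ltr01 divr_gt0 //; lra.
  have d1 : d <= 1 by rewrite ge_min lexx.
  have dM : d * M <= e / 2.
    have : d <= e / (2 * M) by rewrite ge_min lexx orbT.
    have -> : e / (2 * M) = (e / 2) / M by field; lra.
    by rewrite ler_pdivlMr; lra.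
  exists (fun q => abs (q.1 - x) < d /\ abs (q.2 - y) < d); split; last split.
  + move=> q [h1 h2]; exists (fun z => abs (z - x) < d), (fun z => abs (z - y) < d).
    by split; [exact: Kball_open|split; [exact: Kball_open|]].
  + by rewrite /= !subrr abs0; split.
  + move=> [u v] /= [h1 h2] _; apply: H.
    rewrite /GRing.scale /=.
    have -> : u * v - x * y = ((u - x) * (v - y) + (u - x) * y) + x * (v - y) by ring.
    have := absD ((u - x) * (v - y) + (u - x) * y) (x * (v - y)).
    have := absD ((u - x) * (v - y)) ((u - x) * y).
    rewrite !absM; have := abs_ge0 x; have := abs_ge0 y.
    have := abs_ge0 (u - x); have := abs_ge0 (v - y).
    move: h1 h2 dM; rewrite /M.
    move: (abs (u - x)) (abs (v - y)) (abs x) (abs y) => p q r s.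
    move=> h1 h2 dM q0 p0 s0 r0 i1 i2.
    have : p * q <= d * 1 by apply: ler_pM => //; lra.
    have : p * s <= d * s by apply: ler_wpM2r => //; lra.
    have : r * q <= r * d by apply: ler_wpM2l => //; lra.
    by lra.
- exact: abs_ge0.
- exact: absD.
- by move=> a x; rewrite -absM.
- move=> x; exists (fun y => abs (y - x) < 1), (1 + abs x); split; first exact: Kball_open.
  split=> [|y Hy]; first by rewrite subrr abs0.
  by have := absD (y - x) x; rewrite subrK /=; lra.
Qed.

Lemma prodS_wf (S T : sspace K) : wfS abs S -> wfS abs T -> wfS abs (prodS S T).
Proof.
move=> wS wT.
have tS := wf_top wS; have tT := wf_top wT.
have tST := prod_op_topology tS tT; have tK := Kopen_topology.
have tP2 := prod_op_topology tST tST.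
have tKP := prod_op_topology tK tST.
split.
- exact: tST.
- apply: (@cont_on_ext _ _ _ _ _ (fun p : (kcar S * kcar T) * (kcar S * kcar T) =>
     (p.1.1 + p.2.1, p.1.2 + p.2.2))) => //.
  apply: cont_on_pair => //.
  + apply: (cont_on_comp (g := fun p : (kcar S * kcar T) * (kcar S * kcar T) =>
     (p.1.1, p.2.1)) _ _ (wf_add wS)) => //.
    apply: cont_on_pair => //.
      by apply: (cont_on_comp (g := fst) (D' := wholeset)) => //; apply: cont_on_fst.
    by apply: (cont_on_comp (g := snd) (D' := wholeset)) => //;
      [apply: cont_on_snd|apply: cont_on_fst].
  + apply: (cont_on_comp (g := fun p : (kcar S * kcar T) * (kcar S * kcar T) =>
     (p.1.2, p.2.2)) _ _ (wf_add wT)) => //.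
    apply: cont_on_pair => //.
      by apply: (cont_on_comp (g := fst) (D' := wholeset)) => //;
        [apply: cont_on_fst|apply: cont_on_snd].
    by apply: (cont_on_comp (g := snd) (D' := wholeset)) => //; apply: cont_on_snd.
- apply: (@cont_on_ext _ _ _ _ _ (fun p : K * (kcar S * kcar T) =>
     (p.1 *: p.2.1, p.1 *: p.2.2))) => //.
  apply: cont_on_pair => //.
  + apply: (cont_on_comp (g := fun p : K * (kcar S * kcar T) => (p.1, p.2.1)) _ _ (wf_scale wS)) => //.
    apply: cont_on_pair => //; first exact: cont_on_fst.
    by apply: (cont_on_comp (g := snd) (D' := wholeset)) => //;
      [apply: cont_on_snd|apply: cont_on_fst].
  + apply: (cont_on_comp (g := fun p : K * (kcar S * kcar T) => (p.1, p.2.2)) _ _ (wf_scale wT)) => //.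
    apply: cont_on_pair => //; first exact: cont_on_fst.
    by apply: (cont_on_comp (g := snd) (D' := wholeset)) => //; apply: cont_on_snd.
- by move=> x; rewrite le_max (sz_ge0 wS).
- move=> x y; rewrite ge_max /=.
  by rewrite (le_trans (sz_add wS _ _)) ?(le_trans (sz_add wT _ _)) //;
    rewrite lerD // le_max lexx ?orbT.
- move=> a x; rewrite ge_max /=.
  by rewrite (le_trans (sz_scale wS _ _)) ?(le_trans (sz_scale wT _ _)) //;
    rewrite ler_wpM2l ?abs_ge0 // le_max lexx ?orbT.
- move=> x; have [V [R [oV [Vx HV]]]] := sz_locb wS x.1.
  have [V' [R' [oV' [Vx' HV']]]] := sz_locb wT x.2.
  exists (fun p => V p.1 /\ V' p.2), (Num.max R R'); split.
    by move=> p [? ?]; exists V, V'.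
  by split=> // y [/HV h /HV' h']; rewrite ge_max /= !le_max h h' orbT.
Qed.

Lemma tan_wf (S : sspace K) : wfS abs S -> wfS abs (tan abs S).
Proof. by move=> wS; apply: prodS_wf; [exact: prodS_wf|exact: scal_wf]. Qed.

End WellFormed.

(** * Closure properties of the classes [C^k] *)

Section Calculus.
Context {K : fieldType} {abs : K -> RR} (habs : abs_value abs).
Implicit Types (b : bool) (k : nat) (S T W : sspace K).
Local Notation isC := (isC abs).
Local Notation tan := (tan abs).
Local Notation wf := (wfS abs).
Local Notation scal := (scal abs).
Local Notation U1 := (U1 abs).

Lemma mor_sub b S T (U U' : kcar S -> Prop) (f : kcar S -> kcar T) :
  (forall x, U' x -> U x) -> mor b S T U f -> mor b S T U' f.
Proof.
move=> sub [cf bf]; split; first exact: cont_on_sub cf.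
by move=> /bf H R; have [M HM] := H R; exists M => x /sub; apply: HM.
Qed.

Lemma mor_ext b S T (U : kcar S -> Prop) (f g : kcar S -> kcar T) :
  (forall x, U x -> f x = g x) -> mor b S T U f -> mor b S T U g.
Proof.
move=> eq [cf bf]; split; first exact: cont_on_ext cf.
by move=> /bf H R; have [M HM] := H R; exists M => x Ux; rewrite -eq //; apply: HM.
Qed.

Lemma mor_comp b S T W (U : kcar S -> Prop) (V : kcar T -> Prop)
    (f : kcar S -> kcar T) (g : kcar T -> kcar W) :
  (forall x, U x -> V (f x)) -> mor b S T U f -> mor b T W V g -> mor b S W U (g \o f).
Proof.
move=> UV [cf bf] [cg bg]; split; first exact: cont_on_comp cf cg.
move=> B R; have [M HM] := bf B R; have [N HN] := bg B M.
by exists N => x Ux Rx; apply: HN; [apply: UV|apply: HM].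
Qed.

Lemma mor_pair b S T W (U : kcar S -> Prop) (f : kcar S -> kcar T) (g : kcar S -> kcar W) :
  is_topology (kop S) -> mor b S T U f -> mor b S W U g ->
  mor b S (prodS T W) U (fun x => (f x, g x)).
Proof.
move=> tS [cf bf] [cg bg]; split; first exact: cont_on_pair.
move=> B R; have [M HM] := bf B R; have [N HN] := bg B R.
by exists (Num.max M N) => x Ux Rx; rewrite ge_max !le_max /= HM // HN // orbT.
Qed.

Lemma mor_fst b S T (U : kcar (prodS S T) -> Prop) :
  is_topology (kop T) -> mor b (prodS S T) S U fst.
Proof.
move=> tT; split; first exact: cont_on_fst.
by move=> _ R; exists R => x _; rewrite ge_max => /andP[].
Qed.

Lemma mor_snd b S T (U : kcar (prodS S T) -> Prop) :
  is_topology (kop S) -> mor b (prodS S T) T U snd.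
Proof.
move=> tT; split; first exact: cont_on_snd.
by move=> _ R; exists R => x _; rewrite ge_max => /andP[].
Qed.

Lemma mor_cst b S T (U : kcar S -> Prop) (c : kcar T) :
  is_topology (kop S) -> mor b S T U (fun _ => c).
Proof.
by move=> tS; split; [exact: cont_on_cst|move=> _ R; exists (sz T c)].
Qed.

Lemma mor_id b S (U : kcar S -> Prop) : mor b S S U id.
Proof. by split; [exact: cont_on_id|move=> _ R; exists R]. Qed.

Lemma mor_add b T (U : kcar (prodS T T) -> Prop) : wf T ->
  mor b (prodS T T) T U (fun p => p.1 + p.2).
Proof.
move=> wT; apply: (@mor_sub _ _ _ wholeset) => //; split; first exact: (wf_add wT).
move=> _ R; exists (R + R) => x _; rewrite ge_max => /andP[h1 h2].
by rewrite (le_trans (sz_add wT _ _)) // lerD.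
Qed.

Lemma mor_scale b T (U : kcar (prodS scal T) -> Prop) : wf T ->
  mor b (prodS scal T) T U (fun p => (p.1 : K) *: p.2).
Proof.
move=> wT; apply: (@mor_sub _ _ _ wholeset) => //; split; first exact: (wf_scale wT).
move=> _ R; exists (R * R) => x _; rewrite ge_max => /andP[/= h1 h2].
rewrite (le_trans (sz_scale wT _ _)) // ler_pM ?(abs_ge0 habs) //.
exact: sz_ge0 wT _.
Qed.

Lemma U1_sub S (U U' : kcar S -> Prop) :
  (forall x, U' x -> U x) -> forall p, U1 S U' p -> U1 S U p.
Proof. by move=> sub p [/sub ? /sub ?]. Qed.

Lemma isC_mor b k S T U f : isC b k S T U f -> mor b S T U f.
Proof. by case: k => [|k] []. Qed.

Lemma isC_sub b k S T (U U' : kcar S -> Prop) f :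
  (forall x, U' x -> U x) -> isC b k S T U f -> isC b k S T U' f.
Proof.
elim: k S U U' f => [|k IH] S U U' f sub /= [mf H]; split; try exact: mor_sub mf.
  by [].
have [f1 [q c]] := H; exists f1; split; first by move=> p /(U1_sub sub); apply: q.
by apply: (IH (tan S) (U1 S U) _ f1 _ c); exact: U1_sub.
Qed.

Lemma isC_ext b k S T U f g :
  (forall x, U x -> f x = g x) -> isC b k S T U f -> isC b k S T U g.
Proof.
case: k => [|k] eq /= [mf H]; split; try exact: mor_ext mf; first by [].
have [f1 [q c]] := H; exists f1; split=> // p Up.
by rewrite -!eq; [exact: q|case: Up..].
Qed.

Lemma isC_S b k S T U f : isC b k.+1 S T U f -> isC b k S T U f.
Proof.
elim: k S U f => [|k IH] S U f; first by move=> [].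
move=> [mf [f1 [q c]]]; split=> //; exists f1; split=> //; exact: IH.
Qed.

Lemma isC_forget b k S T U f : isC b k S T U f -> isC false k S T U f.
Proof.
elim: k S U f => [|k IH] S U f /= [[cf _] H]; split=> //.
by have [f1 [q c]] := H; exists f1; split=> //; apply: IH.
Qed.

(** The quotient of [L] at [(x, v, t)] is [L v], again linear and continuous in the triple, so the
    induction closes. *)
Lemma isC_lin b k S T U (L : kcar S -> kcar T) : is_topology (kop S) ->
  (forall x y, L (x + y) = L x + L y) -> (forall a x, L (a *: x) = a *: L x) ->
  mor b S T wholeset L -> isC b k S T U L.
Proof.
move=> tS LD LZ mL; apply: (@isC_sub _ _ _ _ wholeset) => // {U}.
elim: k S L tS LD LZ mL => [//|k IH] S L tS LD LZ mL; split=> //.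
have tK := Kopen_topology (abs := abs).
have tSS := prod_op_topology tS tS.
exists (fun p => L p.1.2); split.
  by move=> p _; rewrite LD LZ addrAC subrr add0r.
apply: (@isC_sub _ _ _ _ wholeset) => //; apply: IH.
- exact: prod_op_topology.
- by move=> x y /=; rewrite LD.
- by move=> x y /=; rewrite LZ.
- apply: (@mor_comp b (tan S) S T _ wholeset (fun p => p.1.2) L) => //.
  apply: (@mor_comp b (tan S) (prodS S S) S _ wholeset fst snd) => //.
    exact: mor_fst.
  exact: mor_snd.
Qed.

Lemma isC_fst b k S T U : is_topology (kop S) -> is_topology (kop T) ->
  isC b k (prodS S T) S U fst.
Proof.
by move=> tS tT; apply: isC_lin => //; [exact: prod_op_topology|exact: mor_fst].
Qed.

Lemma isC_snd b k S T U : is_topology (kop S) -> is_topology (kop T) ->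
  isC b k (prodS S T) T U snd.
Proof.
by move=> tS tT; apply: isC_lin => //; [exact: prod_op_topology|exact: mor_snd].
Qed.

Lemma isC_id b k S U : is_topology (kop S) -> isC b k S S U id.
Proof. by move=> tS; apply: isC_lin => //; exact: mor_id. Qed.

Lemma isC_cst b k S T U (c : kcar T) : is_topology (kop S) -> isC b k S T U (fun _ => c).
Proof.
elim: k S U c => [|k IH] S U c tS; split; try exact: mor_cst; first by [].
exists (fun _ => 0); split; first by move=> p _; rewrite subrr scaler0.
apply: IH; apply: prod_op_topology; last exact: Kopen_topology.
exact: prod_op_topology.
Qed.

Lemma tan_top S : is_topology (kop S) -> is_topology (kop (tan S)).
Proof.
by move=> tS; apply: prod_op_topology; [exact: prod_op_topology|exact: Kopen_topology].
Qed.

Lemma isC_pair b k S T W U f g : is_topology (kop S) ->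
  isC b k S T U f -> isC b k S W U g ->
  isC b k S (prodS T W) U (fun x => (f x, g x)).
Proof.
elim: k S U f g => [|k IH] S U f g tS [mf cf] [mg cg]; split; try exact: mor_pair.
  by [].
have [f1 [qf c1]] := cf; have [g1 [qg c2]] := cg.
exists (fun p => (f1 p, g1 p)); split; last by apply: IH => //; exact: tan_top.
move=> p Up; have := qf p Up; have := qg p Up => e1 e2.
by rewrite /GRing.add /GRing.opp /GRing.scale /= /add_pair /scale_pair /= -e1 -e2.
Qed.

(** Chain rule. As [f (x + t v) = f x + t (f1 p)], the map [g1 (f x, f1 p, t)] is a quotient of
    [g \o f], and the induction hypothesis applies to this composition. It is used a second time for
    [f x] viewed as a function of [p]. *)
Lemma isC_comp b k S T W U V f g :
  is_topology (kop S) -> is_topology (kop T) ->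
  (forall x, U x -> V (f x)) -> isC b k S T U f -> isC b k T W V g ->
  isC b k S W U (g \o f).
Proof.
elim: k S T W U V f g => [|k IH] S T W U V f g tS tT UV cf cg.
  by split=> //; exact: mor_comp (isC_mor cf) (isC_mor cg).
have tK := Kopen_topology (abs := abs).
have tSS := prod_op_topology tS tS.
have tTS := tan_top tS; have tTT := tan_top tT.
split; first exact: mor_comp (isC_mor cf) (isC_mor cg).
have [mf [f1 [qf c1]]] := cf; have [mg [g1 [qg c2]]] := cg.
have ef p : U1 S U p -> f p.1.1 + (p.2 : K) *: f1 p = f (p.1.1 + (p.2 : K) *: p.1.2).
  by move=> Up; rewrite -(qf p Up) addrC subrK.
exists (g1 \o (fun p => ((f p.1.1, f1 p), p.2))); split.
  move=> p Up; have := qg ((f p.1.1, f1 p), p.2); rewrite /= => <-; first by rewrite ef.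
  by split; rewrite /= ?ef //; case: Up => ? ?; apply: UV.
apply: (IH _ (tan T) _ _ (U1 T V)) => //.
- by move=> p Up; split; rewrite /= ?ef //; case: Up => ? ?; apply: UV.
- apply: (@isC_pair b k (tan S) (prodS T T) scal) => //; last exact: isC_snd.
  apply: isC_pair => //.
  apply: (IH (tan S) S T _ U (fun p => p.1.1) f) => //.
  + by move=> p [].
  + by apply: (IH (tan S) (prodS S S) S _ wholeset fst fst) => //; exact: isC_fst.
  + exact: isC_S cf.
Qed.

Lemma isC_add b k S T U f g : is_topology (kop S) -> wf T ->
  isC b k S T U f -> isC b k S T U g -> isC b k S T U (fun x => f x + g x).
Proof.
move=> tS wT cf cg; have tT := wf_top wT.
apply: (@isC_comp b k S (prodS T T) T U wholeset (fun x => (f x, g x)) (fun p => p.1 + p.2)) => //.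
- exact: prod_op_topology.
- exact: isC_pair.
- apply: isC_lin => /=.
  + exact: prod_op_topology.
  + by move=> x y; rewrite addrACA.
  + by move=> a x; rewrite scalerDr.
  + exact: mor_add.
Qed.

Lemma isC_Zl b k S T U (a : K) f : is_topology (kop S) -> wf T ->
  isC b k S T U f -> isC b k S T U (fun x => a *: f x).
Proof.
move=> tS wT cf; have tT := wf_top wT.
apply: (@isC_comp b k S T T U wholeset f (fun y => a *: y)) => //.
apply: isC_lin => //=.
- by move=> x y; rewrite scalerDr.
- by move=> c x; rewrite !scalerA mulrC.
- apply: (mor_comp (T := prodS scal T) (f := fun y => (a, y)) (V := wholeset)
    (g := fun p => (p.1 : K) *: p.2)) => //; last exact: mor_scale.
  by apply: mor_pair => //; [exact: mor_cst|exact: mor_id].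
Qed.

Lemma isC_opp b k S T U f : is_topology (kop S) -> wf T ->
  isC b k S T U f -> isC b k S T U (fun x => - f x).
Proof.
move=> tS wT cf; apply: (@isC_ext _ _ _ _ _ (fun x => (-1) *: f x)).
  by move=> x _; rewrite scaleN1r.
exact: isC_Zl.
Qed.

Lemma isC_subr b k S T U f g : is_topology (kop S) -> wf T ->
  isC b k S T U f -> isC b k S T U g -> isC b k S T U (fun x => f x - g x).
Proof. by move=> tS wT cf cg; apply: isC_add => //; apply: isC_opp. Qed.

Lemma scale_increment (V : lmodType K) (a c t : K) (x y : V) :
  (a + t * c) *: (x + t *: y) - a *: x = t *: (a *: y + c *: x + t *: (c *: y)).
Proof.
apply/eqP; rewrite subr_eq; apply/eqP; rewrite scalerDl !scalerDr !scalerA.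
by rewrite [t * a]mulrC [t * t * c]mulrAC [RHS]addrC !addrA.
Qed.

(** By the discrete product rule [scale_increment], the quotient is a sum of products of components
    of the triple; the induction hypothesis, composed with these components, handles each
    product. *)
Lemma isC_scale0 b k T U : wf T -> isC b k (prodS scal T) T U (fun p => (p.1 : K) *: p.2).
Proof.
move=> wT; apply: (@isC_sub _ _ _ _ wholeset) => // {U}.
have tT := wf_top wT; have tK := Kopen_topology (abs := abs); have tKT := prod_op_topology tK tT.
elim: k => [|k IH]; split; try exact: mor_scale; first by [].
pose S := tan (prodS scal T).
have tS : is_topology (kop S) by exact: tan_top.
have c0 : isC b k S scal wholeset snd.
  by apply: isC_snd => //; exact: prod_op_topology.
have c1 : isC b k S (prodS scal T) wholeset (fun p => p.1.1).
  apply: (@isC_comp b k S (prodS (prodS scal T) (prodS scal T)) _ _ wholeset fst fst) => //.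
  - exact: prod_op_topology.
  - by apply: isC_fst => //; exact: prod_op_topology.
  - exact: isC_fst.
have c2 : isC b k S (prodS scal T) wholeset (fun p => p.1.2).
  apply: (@isC_comp b k S (prodS (prodS scal T) (prodS scal T)) _ _ wholeset fst snd) => //.
  - exact: prod_op_topology.
  - by apply: isC_fst => //; exact: prod_op_topology.
  - exact: isC_snd.
have cc (h : kcar S -> kcar scal) (g : kcar S -> kcar T) : isC b k S scal wholeset h ->
  isC b k S T wholeset g -> isC b k S T wholeset (fun p => (h p : K) *: g p).
  move=> ch cg; apply: (@isC_comp b k S (prodS scal T) T _ wholeset (fun p => (h p, g p))
    (fun p => (p.1 : K) *: p.2)) => //.
  exact: isC_pair.
have cf (g : kcar S -> kcar (prodS scal T)) : isC b k S (prodS scal T) wholeset g ->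
    isC b k S scal wholeset (fun p => (g p).1).
  by move=> cg; apply: (@isC_comp b k S (prodS scal T) _ _ wholeset g fst) => //; exact: isC_fst.
have cs (g : kcar S -> kcar (prodS scal T)) : isC b k S (prodS scal T) wholeset g ->
    isC b k S T wholeset (fun p => (g p).2).
  by move=> cg; apply: (@isC_comp b k S (prodS scal T) _ _ wholeset g snd) => //; exact: isC_snd.
exists (fun p => ((p.1.1.1 : K) *: p.1.2.2 + (p.1.2.1 : K) *: p.1.1.2)
    + (p.2 : K) *: ((p.1.2.1 : K) *: p.1.2.2)); split.
  move=> [[[a x] [c y]] t] _ /=; exact: (@scale_increment (kcar T)).
apply: (@isC_sub _ _ _ _ wholeset) => //.
apply: isC_add => //; first apply: isC_add => //.
- by apply: cc; [exact: cf c1|exact: cs c2].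
- by apply: cc; [exact: cf c2|exact: cs c1].
- by apply: (cc) => //; apply: cc; [exact: cf c2|exact: cs c2].
Qed.

Lemma isC_smul b k S T U f g : is_topology (kop S) -> wf T ->
  isC b k S scal U f -> isC b k S T U g -> isC b k S T U (fun x => (f x : K) *: g x).
Proof.
move=> tS wT cf cg; have tT := wf_top wT; have tK := Kopen_topology (abs := abs).
apply: (@isC_comp b k S (prodS scal T) T _ wholeset (fun p => (f p, g p))
    (fun p => (p.1 : K) *: p.2)) => //.
- exact: prod_op_topology.
- exact: isC_pair.
- exact: isC_scale0.
Qed.

Lemma isC_mul b k S U (f g : kcar S -> kcar scal) : is_topology (kop S) ->
  isC b k S scal U f -> isC b k S scal U g -> isC b k S scal U (fun x => (f x : K) * (g x : K)).
Proof. by move=> tS cf cg; apply: (@isC_smul b k S scal) => //; exact: scal_wf. Qed.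

End Calculus.

(** * Uniqueness of difference quotients and locality *)

Lemma bernoulli (h : RR) n : 0 <= h -> 1 + n%:R * h <= (1 + h) ^+ n.
Proof.
move=> h0; elim: n => [|n IH]; first by rewrite mul0r addr0 expr0.
rewrite exprS -natr1 mulrDl mul1r.
have : 0 <= n%:R * h :> RR by rewrite mulr_ge0 // ler0n.
move: (n%:R * h) IH => u IH u0; nra.
Qed.

Lemma expr_small (q e : RR) : 0 < q -> q < 1 -> 0 < e -> exists n, q ^+ n < e.
Proof.
move=> q0 q1 e0; pose h := q^-1 - 1.
have qV : 1 < q^-1 by rewrite invf_gt1.
have h0 : 0 < h by rewrite /h; lra.
have [n Hn] : exists n : nat, e^-1 / h < n%:R.
  by exists (Num.bound (e^-1 / h)); apply: archi_boundP; rewrite divr_ge0 ?invr_ge0 ?ltW.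
exists n.
have hq : 1 + h = q^-1 by rewrite /h; lra.
have := bernoulli n (ltW h0); rewrite hq.
move: Hn; rewrite ltr_pdivrMr // => Hn Hb.
have {Hn Hb}: e^-1 < q^-1 ^+ n.
  by apply: lt_le_trans Hn (le_trans _ Hb); rewrite lerDr ler01.
by rewrite exprVn ltf_pV2 // posrE ?exprn_gt0.
Qed.

Section PlainCalculus.
Context {K : fieldType} {abs : K -> RR} (habs : abs_value abs) (hnt : nontrivial_abs abs).
Implicit Types (b : bool) (k : nat) (S T : sspace K).
Local Notation isC := (isC abs).
Local Notation tan := (tan abs).
Local Notation wf := (wfS abs).
Local Notation scal := (scal abs).
Local Notation U1 := (U1 abs).

Lemma small_scalar (e : RR) : 0 < e -> exists2 a : K, a != 0 & abs a < e.
Proof.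
move=> e0; have [x [x0 x1]] := hnt.
have nx : x != 0 by apply/eqP => /(abs_eq0 habs).
have [y y0 y1] : exists2 y : K, y != 0 & abs y < 1.
  have := abs_gt0 habs nx => gx.
  case: (ltgtP (abs x) 1) => // h; first by exists x.
  by exists x^-1; rewrite ?invr_eq0 // (absV habs) invf_lt1.
have [n Hn] := expr_small (abs_gt0 habs y0) y1 e0.
by exists (y ^+ n); rewrite ?expf_neq0 // (absX habs).
Qed.

(** A limit along a single line, with [t = 0] excluded. This weak notion already determines the
    value at [t = 0] of a continuous quotient. *)
Definition isD S T (f : kcar S -> kcar T) (x v : kcar S) (l : kcar T) : Prop :=
  forall W, kop T W -> W l -> exists d : RR, 0 < d /\
    forall t : K, t != 0 -> abs t < d -> W (t^-1 *: (f (x + t *: v) - f x)).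

Lemma isD_uniq S T (f : kcar S -> kcar T) x v l l' :
  hausdorff (kop T) -> isD f x v l -> isD f x v l' -> l = l'.
Proof.
move=> hT Hl Hl'; apply: contrapT => /hT [V [W [oV [oW [Vl [Wl H]]]]]].
have [d [d0 Hd]] := Hl V oV Vl; have [d' [d0' Hd']] := Hl' W oW Wl.
have [|a a0] := @small_scalar (Num.min d d'); first by rewrite lt_min d0.
by rewrite lt_min => /andP[h h']; apply: (H _ (Hd a a0 h) (Hd' a a0 h')).
Qed.

Lemma open_line S (U : kcar S -> Prop) (x v : kcar S) : wf S -> kop S U -> U x ->
  exists d : RR, 0 < d /\ forall t : K, abs t < d -> U (x + t *: v).
Proof.
move=> wS oU Ux; have tS := wf_top wS.
have c : isC false 0 scal S wholeset (fun t => x + (t : K) *: v).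
  have tK := Kopen_topology (abs := abs).
  apply: isC_add => //; first exact: isC_cst.
  by apply: isC_smul => //; [exact: isC_id|exact: isC_cst].
have [[cc _] _] := c.
have [|V [oV [V0 HV]]] := cc 0 I U oU; first by rewrite scale0r addr0.
have [d [d0 Hd]] := oV 0 V0; exists d; split=> // t Ht.
by apply: HV => //; apply: Hd; rewrite subr0.
Qed.

Lemma quot_isD S T U (f : kcar S -> kcar T) (f1 : kcar (tan S) -> kcar T) x v :
  wf S -> kop S U -> quot abs S T U f f1 ->
  cont_on (kop (tan S)) (kop T) (U1 S U) f1 -> U x -> isD f x v (f1 ((x, v), 0)).
Proof.
move=> wS oU qf cf Ux W oW Wl.
have [|V [oV [V0 HV]]] := cf ((x, v), 0) _ W oW Wl.
  by split; rewrite /= ?scale0r ?addr0.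
have [A [B [oA [oB [/= Ax [B0 HAB]]]]]] := oV _ V0.
have [d [d0 Hd]] := oB _ B0; have [d' [d0' Hd']] := open_line v wS oU Ux.
exists (Num.min d d'); split; first by rewrite lt_min d0.
move=> t t0; rewrite lt_min => /andP[td td'].
have Up : U1 S U ((x, v), t) by split=> //=; exact: Hd'.
have := qf _ Up; rewrite /= => ->; rewrite scalerA mulVf // scale1r.
by apply: HV => //; apply: HAB => //=; apply: Hd; rewrite subr0.
Qed.

(** A canonical quotient, defined everywhere without any assumption on [f]: at [t = 0] it is the
    directional derivative, with default [0] if there is none. Local quotients can then be glued by
    comparing each of them with [dq]. *)
Definition dq S T (f : kcar S -> kcar T) (p : kcar (tan S)) : kcar T :=
  if (p.2 : K) == 0 then
    match pselect (exists l, isD f p.1.1 p.1.2 l) with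
    | left h => sval (cid h) | right _ => 0 end
  else (p.2 : K)^-1 *: (f (p.1.1 + (p.2 : K) *: p.1.2) - f p.1.1).

Lemma dq_isD S T (f : kcar S -> kcar T) x v l :
  hausdorff (kop T) -> isD f x v l -> dq f ((x, v), 0) = l.
Proof.
move=> hT Hl; rewrite /dq /= eqxx; case: pselect => [h|[]]; last by exists l.
by apply: (isD_uniq hT _ Hl); case: cid.
Qed.

Lemma dq_quot S T U (f : kcar S -> kcar T) : quot abs S T U f (dq f).
Proof.
move=> p Up; rewrite /dq; case: eqP => [->|/eqP p0].
  by rewrite !scale0r addr0 subrr.
by rewrite scalerA divff // scale1r.
Qed.

(** Two quotients can differ only at [t = 0], and there continuity makes each of them the
    directional derivative. *)
Lemma quot_dq S T U (f : kcar S -> kcar T) (f1 : kcar (tan S) -> kcar T) :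
  wf S -> hausdorff (kop T) -> kop S U -> quot abs S T U f f1 ->
  cont_on (kop (tan S)) (kop T) (U1 S U) f1 -> forall p, U1 S U p -> f1 p = dq f p.
Proof.
move=> wS hT oU qf cf [[x v] t] Up; have [t0|t0] := eqVneq (t : K) 0.
  rewrite t0; symmetry; apply: dq_isD => //.
  by apply: (quot_isD (U := U)) => //; case: Up.
by rewrite /dq /= (negPf t0); have := qf _ Up; rewrite /= => ->; rewrite scalerA mulVf // scale1r.
Qed.

Lemma isC_base b k S U : is_topology (kop S) -> isC b k (tan S) S U (fun p => p.1.1).
Proof.
move=> tS; have tK := Kopen_topology (abs := abs); have tSS := prod_op_topology tS tS.
apply: (@isC_comp _ _ b k (tan S) (prodS S S) S _ wholeset fst fst) => //.
- exact: prod_op_topology.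
- exact: isC_fst.
- exact: isC_fst.
Qed.

Lemma isC_dir b k S U : is_topology (kop S) -> isC b k (tan S) S U (fun p => p.1.2).
Proof.
move=> tS; have tK := Kopen_topology (abs := abs); have tSS := prod_op_topology tS tS.
apply: (@isC_comp _ _ b k (tan S) (prodS S S) S _ wholeset fst snd) => //.
- exact: prod_op_topology.
- exact: isC_fst.
- exact: isC_snd.
Qed.

Lemma isC_par b k S U : is_topology (kop S) -> isC b k (tan S) scal U snd.
Proof.
move=> tS; have tK := Kopen_topology (abs := abs); have tSS := prod_op_topology tS tS.
exact: isC_snd.
Qed.

Lemma isC_shift b k S U : wf S ->
  isC b k (tan S) S U (fun p => p.1.1 + (p.2 : K) *: p.1.2).
Proof.
move=> wS; have tS := wf_top wS; have tT := wf_top (tan_wf habs wS).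
apply: isC_add => //; first exact: isC_base.
by apply: isC_smul => //; [exact: isC_par|exact: isC_dir].
Qed.

Lemma isC_open b k S T f (A : kcar T -> Prop) : is_topology (kop S) ->
  isC b k S T wholeset f -> kop T A -> kop S (fun x => A (f x)).
Proof. by move=> tS /isC_mor [cf _] oA; exact: open_preimage cf oA. Qed.

Lemma U1_open S U : wf S -> kop S U -> kop (tan S) (U1 S U).
Proof.
move=> wS oU; have tT := wf_top (tan_wf habs wS).
have [_ [_ topI]] := tT; apply: topI.
  by apply: (isC_open (b := false) (k := 0) tT _ oU); exact: isC_base (wf_top wS).
by apply: (isC_open (b := false) (k := 0) tT _ oU); exact: isC_shift.
Qed.

Lemma neq0_open : Kopen abs (fun t => t != 0).
Proof.
move=> t t0; exists (abs t); split; first exact: abs_gt0.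
by move=> y; apply: contraTneq => ->; rewrite sub0r (absN habs) ltxx.
Qed.

Lemma cont_inv : cont_on (Kopen abs) (Kopen abs) (fun t => t != 0) (fun t : K => t^-1).
Proof.
move=> x x0 W oW /oW [e [e0 He]].
have ax := abs_gt0 habs x0.
(* The first bound forces [|y| > |x| / 2]; the second then makes [|y - x| / (|x| |y|)] smaller than
   [e]. *)
pose d := Num.min (abs x / 2) (e * (abs x * abs x / 2)).
have d0 : 0 < d.
  by rewrite lt_min divr_gt0 //= mulr_gt0 // divr_gt0 // mulr_gt0.
exists (fun y => abs (y - x) < d); split; first exact: Kball_open.
split=> [|y Hy y0]; first by rewrite subrr (abs0 habs).
apply: He; have ay := abs_gt0 habs y0.
have -> : y^-1 - x^-1 = (x - y) / (x * y).
  by field; rewrite x0 y0.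
rewrite (absM habs) (absV habs) (absM habs) (absB habs) ltr_pdivrMr ?mulr_gt0 //.
move: Hy; rewrite lt_min => /andP[h1 h2].
have : abs x / 2 < abs y.
  by have := absD habs (x - y) y; rewrite subrK (absB habs x); lra.
move: h2 ax ay; move: (abs (y - x)) (abs x) (abs y) => p q r h2 q0 r0 h.
have : e * (q * (q / 2)) < e * (q * r) by rewrite !ltr_pM2l.
by rewrite mulrA in h2 *; lra.
Qed.

(** The quotient is [- v / (x (x + t v))], a product of inverses, so induction applies. The flag is
    [false] because inversion is unbounded near [0]. *)
Lemma isC_inv0 k : isC false k scal scal (fun t => t != 0) (fun t : K => t^-1).
Proof.
have wK := scal_wf habs; have tK := Kopen_topology (abs := abs).
have tTK := wf_top (tan_wf habs wK).
have mi : mor false scal scal (fun t => t != 0) (fun t : K => t^-1).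
  by split=> //; exact: cont_inv.
elim: k => [|k IH]; split=> //.
exists (fun p => - (p.1.2 : K) * ((p.1.1 : K)^-1 * (p.1.1 + (p.2 : K) * p.1.2 : K)^-1)).
split.
  move=> [[x v] t] [/= x0 y0]; rewrite /GRing.scale /=.
  by move: y0; rewrite /GRing.scale /= => y0; field; rewrite x0 y0.
have cX : isC false k (tan scal) scal (U1 scal (fun t => t != 0))
    ((fun t : K => t^-1) \o (fun p : kcar (tan scal) => p.1.1)).
  by apply: isC_comp IH => //; [move=> p []|exact: isC_base].
have cY : isC false k (tan scal) scal (U1 scal (fun t => t != 0))
    ((fun t : K => t^-1) \o (fun p : kcar (tan scal) => (p.1.1 : kcar scal) + (p.2 : K) *: p.1.2)).
  by apply: isC_comp IH => //; [move=> p []|exact: isC_shift].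
have cV : isC false k (tan scal) scal (U1 scal (fun t => t != 0)) (fun p => - (p.1.2 : K)).
  by apply: isC_opp => //; exact: isC_dir.
exact: (isC_mul habs tTK cV (isC_mul habs tTK cX cY)).
Qed.

Lemma isC_inv k S U (f : kcar S -> kcar scal) : is_topology (kop S) ->
  (forall x, U x -> f x != 0) -> isC false k S scal U f ->
  isC false k S scal U (fun x => (f x : K)^-1).
Proof.
move=> tS f0 cf; have tK := Kopen_topology (abs := abs).
exact: (isC_comp (T := scal) tS tK f0 cf (isC_inv0 k)).
Qed.

(** A quotient compares two points, which no single neighbourhood need contain. For [t = 0] they
    coincide, and the local quotient agrees with [dq]. For [t] non-zero, [dq] is built from the
    inverse of [t] and from [f], which is of class [C^k] on all of [U] by induction. *)
Lemma isC_local k S T U (f : kcar S -> kcar T) :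
  wf S -> wf T -> hausdorff (kop T) -> kop S U ->
  (forall x, U x -> exists V, kop S V /\ V x /\ isC false k S T (fun y => U y /\ V y) f) ->
  isC false k S T U f.
Proof.
elim: k S U f => [|k IH] S U f wS wT hT oU H.
  split=> //; split=> // x Ux W oW Wx; have [V [oV [Vx [[cf _] _]]]] := H x Ux.
  have [A [oA [Ax HA]]] := cf x (conj Ux Vx) W oW Wx.
  have [_ [_ topI]] := wf_top wS.
  by exists (fun y => A y /\ V y); split; [exact: topI|split=> // y [? ?] ?; apply: HA].
have cf : isC false k S T U f.
  by apply: IH => // x /H [V [oV [Vx c]]]; exists V; do 2!split=> //; exact: isC_S c.
split; first exact: isC_mor cf.
have wTS := tan_wf habs wS; have tS := wf_top wS; have tTS := wf_top wTS.
exists (dq f); split; first exact: dq_quot.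
apply: IH => //; first exact: U1_open.
move=> [[x v] t] Up; have [t0|t0] := eqVneq (t : K) 0.
  have [V [oV [Vx c]]] := H x (proj1 Up).
  have oUV : kop S (fun y => U y /\ V y) by case: tS => _ [_]; apply.
  exists (U1 S V); split; first exact: U1_open.
  split; first by split; rewrite //= t0 scale0r addr0.
  have [_ [f1 [q1 c1]]] := c.
  apply: (@isC_sub _ _ _ _ (tan S) _ (U1 S (fun y => U y /\ V y))); first by move=> p [[? ?] [? ?]].
  apply: (isC_ext _ c1).
  exact: (quot_dq (f1 := f1) wS hT oUV q1 (proj1 (isC_mor c1))).
exists (fun p : kcar (tan S) => (p.2 : K) != 0); split; last split=> //.
  have cp := @isC_par false 0 S wholeset tS.
  exact: (isC_open (T := scal) tTS cp neq0_open).
apply: (@isC_ext _ _ _ _ _ _ _ (fun p : kcar (tan S) =>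
  (p.2 : K)^-1 *: (f (p.1.1 + (p.2 : K) *: p.1.2) - f p.1.1))).
  by move=> p [_ p0]; rewrite /dq (negPf p0).
apply: isC_smul => //.
  apply: isC_inv => //; last exact: isC_par.
  by move=> p [].
apply: isC_subr => //.
  apply: (isC_comp (f := fun p : kcar (tan S) => p.1.1 + (p.2 : K) *: p.1.2) _ _ _ _ cf) => //.
    by move=> p [[]].
  exact: isC_shift.
apply: (isC_comp (f := fun p : kcar (tan S) => p.1.1) _ _ _ _ cf) => //.
  by move=> p [[]].
exact: isC_base.
Qed.

End PlainCalculus.

(** * Cut-off functions *)

Lemma cont_onP {K : fieldType} (abs : K -> RR) (habs : abs_value abs) {X : Type}
    (opX : (X -> Prop) -> Prop) (D : X -> Prop) (f : X -> K) :
  cont_on opX (Kopen abs) D f <->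
  forall x, D x -> forall e : RR, 0 < e ->
    exists V, opX V /\ V x /\ forall y, V y -> D y -> abs (f y - f x) < e.
Proof.
split=> H x Dx.
  move=> e e0; apply: (H x Dx (fun z => abs (z - f x) < e)); first exact: Kball_open.
  by rewrite subrr (abs0 habs).
move=> W oW /oW [e [e0 He]]; have [V [oV [Vx HV]]] := H x Dx e e0.
by exists V; split=> //; split=> // y Vy Dy; apply: He; apply: HV.
Qed.

(** * The indicator of the open unit ball over an ultrametric field *)

Section UltrametricCutoff.
Context {K : fieldType} {abs : K -> RR} (habs : abs_value abs) (hu : ultrametric abs).
Local Notation isC := (isC abs).
Local Notation scal := (scal abs).
Local Notation tan := (tan abs).

Definition ball_ind (x : K) : K := if abs x < 1 then 1 else 0.
(** Where [ball_ind] changes along an increment [t v], one has [|t v| >= 1] and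
    [1/t = v * outer_inv (t v)]. Setting the inverse to [0] on the ball keeps it bounded and defined
    everywhere. *)
Definition outer_inv (x : K) : K := if abs x < 1 then 0 else x^-1.

Lemma ultra_shift x y : abs y < 1 -> (abs (x + y) < 1) = (abs x < 1).
Proof.
move=> y1; apply/idP/idP => h; last by rewrite (le_lt_trans (hu _ _)) // gt_max h.
have -> : x = (x + y) + - y by rewrite addrK.
by rewrite (le_lt_trans (hu _ _)) // gt_max h (absN habs).
Qed.

Lemma ball_ind_shift x y : abs y < 1 -> ball_ind (x + y) = ball_ind x.
Proof. by move=> y1; rewrite /ball_ind ultra_shift. Qed.

Lemma mor_ball_ind : mor true scal scal wholeset ball_ind.
Proof.
split.
  apply/(cont_onP habs) => x _ e e0; exists (fun y => abs (y - x) < 1).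
  split; first exact: Kball_open.
  split=> [|y Hy _]; first by rewrite subrr (abs0 habs).
  by rewrite -(ball_ind_shift x Hy) [x + _]addrC subrK subrr (abs0 habs).
move=> _ R; exists 1 => x _ _; rewrite /= /ball_ind.
by case: ifP; rewrite ?(abs0 habs) ?(abs1 habs).
Qed.

Lemma mor_outer_inv : mor true scal scal wholeset outer_inv.
Proof.
have H x y : abs (y - x) < 1 -> (abs y < 1) = (abs x < 1).
  by move=> h; rewrite -(ultra_shift x h) [x + _]addrC subrK.
split.
  apply/(cont_onP habs) => x _ e e0; have [x1|x1] := boolP (abs x < 1).
    exists (fun y => abs (y - x) < 1); split; first exact: Kball_open.
    split=> [|y Hy _]; first by rewrite subrr (abs0 habs).
    by rewrite /outer_inv (H x) // x1 subrr (abs0 habs).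
  have x0 : x != 0 by apply: contraNneq x1 => ->; rewrite (abs0 habs).
  have [V [oV [Vx HV]]] := (proj1 (cont_onP habs _ _ _) (cont_inv habs)) x x0 e e0.
  exists (fun y => V y /\ abs (y - x) < 1); split.
    by case: (Kopen_topology (abs := abs)) => _ [_]; apply=> //; exact: Kball_open.
  split=> [|y [Vy Hy] _]; first by rewrite subrr (abs0 habs).
  have y1 : ~~ (abs y < 1) by rewrite (H x).
  rewrite /outer_inv (negPf x1) (negPf y1); apply: HV => //.
  by apply: contraNneq y1 => ->; rewrite (abs0 habs).
move=> _ R; exists 1 => x _ _; rewrite /= /outer_inv.
case: ltP => h; rewrite ?(abs0 habs) // (absV habs) invf_le1 //; lra.
Qed.

(* Divided differences of each of the two functions are polynomials in values of both. *)
Lemma isC_ball_outer k : isC true k scal scal wholeset ball_ind /\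
  isC true k scal scal wholeset outer_inv.
Proof.
have wK := scal_wf habs; have wT := tan_wf habs wK.
have tK := wf_top wK; have tT := wf_top wT.
elim: k => [|k [IHe IHj]].
  by split; split=> //; [exact: mor_ball_ind|exact: mor_outer_inv].
pose X (p : kcar (tan scal)) : K := p.1.1.
pose V (p : kcar (tan scal)) : K := p.1.2.
pose Y (p : kcar (tan scal)) : K := (p.1.1 : K) + (p.2 : K) *: p.1.2.
pose Z (p : kcar (tan scal)) : K := (p.2 : K) * p.1.2.
have cX : isC true k (tan scal) scal wholeset X by exact: isC_base.
have cV : isC true k (tan scal) scal wholeset V by exact: isC_dir.
have cY : isC true k (tan scal) scal wholeset Y by exact: isC_shift.
have cZ : isC true k (tan scal) scal wholeset Z.
  by apply: isC_mul => //; exact: isC_par.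
have comp (f : K -> K) (h : kcar (tan scal) -> K) : isC true k scal scal wholeset f ->
    isC true k (tan scal) scal wholeset h -> isC true k (tan scal) scal wholeset (f \o h).
  by move=> cf ch; apply: (isC_comp (T := scal) _ _ _ ch cf).
have aux t v : ~~ (abs (t * v) < 1) -> t * v * outer_inv (t * v) = 1.
  move=> h; rewrite /outer_inv (negPf h) divff //.
  by apply: contraNneq h => ->; rewrite (abs0 habs).
split; split; try exact: mor_ball_ind; try exact: mor_outer_inv.
  exists (fun p => V p * ((ball_ind (Y p) - ball_ind (X p)) * outer_inv (Z p))); split.
    move=> [[x v] t] _; rewrite /V /Y /X /Z /= /GRing.scale /=.
    have [h|/aux h] := boolP (abs (t * v) < 1).
      by rewrite ball_ind_shift // subrr mul0r !mulr0.
    by rewrite !mulrA mulrAC h mul1r.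
  apply: (isC_sub (U := wholeset)) => //.
  by do !apply: isC_mul => //; [apply: isC_subr => //|]; apply: comp.
(* An increment with [|t v| < 1] stays on its side of the ball, where the function is [0] or [x^-1];
   this is the first summand. For a larger increment one divides by [t] through [outer_inv]. The
   factor [ball_ind (Z p)] selects the case. *)
exists (fun p => - V p * (outer_inv (X p) * (outer_inv (Y p) * ball_ind (Z p)))
   + V p * ((outer_inv (Y p) - outer_inv (X p)) * outer_inv (Z p))); split.
  move=> [[x v] t] _; rewrite /V /Y /X /Z /= /GRing.scale /=.
  have [h|h] := boolP (abs (t * v) < 1); last first.
    have -> : ball_ind (t * v) = 0 by rewrite /ball_ind (negPf h).
    rewrite !mulr0 add0r.
    by rewrite !mulrA mulrAC aux // mul1r.
  have -> : ball_ind (t * v) = 1 by rewrite /ball_ind h.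
  have -> : outer_inv (t * v) = 0 by rewrite /outer_inv h.
  rewrite !mulr0 addr0 mulr1 /outer_inv (ultra_shift x h).
  case: ifPn => [_|hx]; first by rewrite subr0 mul0r !mulr0.
  have x0 : x != 0 by apply: contraNneq hx => ->; rewrite (abs0 habs).
  have y0 : x + t * v != 0.
    by rewrite -(ultra_shift x h) in hx; apply: contraNneq hx => ->; rewrite (abs0 habs).
  by field; rewrite x0 y0.
apply: (isC_sub (U := wholeset)) => //; apply: isC_add => //.
  apply: isC_mul => //; first exact: isC_opp.
  by do !apply: isC_mul => //; apply: comp.
by do !apply: isC_mul => //; [apply: isC_subr => //|]; apply: comp.
Qed.

End UltrametricCutoff.

(** * The real bump, transported to [K] along an isomorphism with the reals *)

Section RealCutoff.
Context {K : fieldType} {abs : K -> RR} (habs : abs_value abs).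
Context (phi : K -> RR) (psi : RR -> K) (phiK : cancel phi psi) (psiK : cancel psi phi).
Context (phiD : forall x y, phi (x + y) = phi x + phi y)
  (phiM : forall x y, phi (x * y) = phi x * phi y) (phi1 : phi 1 = 1)
  (absE : forall x, abs x = `|phi x|).
Local Notation isC := (isC abs).
Local Notation scal := (scal abs).
Local Notation tan := (tan abs).

Lemma phi0 : phi 0 = 0.
Proof. by apply: (addrI (phi 0)); rewrite -phiD !addr0. Qed.
Lemma phiN x : phi (- x) = - phi x.
Proof. by apply: (addrI (phi x)); rewrite -phiD !subrr phi0. Qed.
Lemma phiB x y : phi (x - y) = phi x - phi y.
Proof. by rewrite phiD phiN. Qed.
Lemma abs_psi r : abs (psi r) = `|r|. Proof. by rewrite absE psiK. Qed.
Lemma psiB r s : psi r - psi s = psi (r - s)%R.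
Proof. by apply: (can_inj phiK); rewrite phiB !psiK. Qed.
Lemma psiM r s : psi r * psi s = psi (r * s)%R.
Proof. by apply: (can_inj phiK); rewrite phiM !psiK. Qed.

Lemma econtP (h : RR -> RR) : econt h <->
  forall s (e : RR), 0 < e -> exists d : RR, 0 < d /\
    forall s', `|s' - s| < d -> `|h s' - h s| < e.
Proof.
split=> H s e.
  move=> /RltP e0; have [d [/RltP d0 Hd]] := H s e e0; exists d; split=> // s' /RltP hs.
  by apply/RltP; rewrite -RabsE; apply: Hd; rewrite RabsE.
move=> /RltP e0; have [d [/RltP d0 Hd]] := H s e e0; exists d; split=> // s' hs.
by rewrite RabsE; apply/RltP; apply: Hd; apply/RltP; rewrite -RabsE.
Qed.

Lemma avgB (h g : RR -> RR) : econt h -> econt g ->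
  avg h - avg g = avg (fun s => h s - g s).
Proof. by move=> ch cg; symmetry; exact: avg_minus. Qed.

Lemma avgZ (c : RR) (h : RR -> RR) : econt h -> c * avg h = avg (fun s => c * h s).
Proof. by move=> ch; symmetry; exact: avg_scal. Qed.

Definition avgK (S : sspace K) (h : kcar (prodS scal S) -> kcar scal) (y : kcar S) : kcar scal :=
  psi (avg (fun s => phi (h (psi s, y)))).

Lemma section_near S (h : kcar (prodS scal S) -> kcar scal) y :
  mor true (prodS scal S) scal wholeset h -> forall s (e : RR), 0 < e ->
  exists (d : RR) V, 0 < d /\ kop S V /\ V y /\ forall s' y', `|s' - s| < d -> V y' ->
    `|phi (h (psi s', y')) - phi (h (psi s, y))| < e.
Proof.
move=> [ch _] s e e0.
have [V [oV [Vx HV]]] := proj1 (cont_onP habs _ _ _) ch (psi s, y) I e e0.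
have [A [B [oA [oB [/= Ax [Bx HAB]]]]]] := oV _ Vx.
have [d [d0 Hd]] := oA _ Ax; exists d, B; do 3!split=> //.
move=> s' y' hs By; rewrite -phiB -absE; apply: HV => //; apply: HAB => //=.
by apply: Hd; rewrite psiB abs_psi.
Qed.

Lemma section_econt S (h : kcar (prodS scal S) -> kcar scal) y :
  mor true (prodS scal S) scal wholeset h -> econt (fun s => phi (h (psi s, y))).
Proof.
move=> mh; apply/econtP => s e e0; have [d [V [d0 [_ [Vy H]]]]] := section_near y mh s e0.
by exists d; split=> // s' hs; apply: H.
Qed.

Lemma mor_avgK S (h : kcar (prodS scal S) -> kcar scal) : wfS abs S ->
  mor true (prodS scal S) scal wholeset h -> mor true S scal wholeset (avgK h).
Proof.
move=> wS mh; split.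
  apply/(cont_onP habs) => y _ e e0.
  have e20 : 0 < e / 2 by lra.
  have [_ [_ topI]] := wf_top wS.
  have [||V [oV [Vy HV]]] := @tube _ (kop S)
    (fun s y' => `|phi (h (psi s, y')) - phi (h (psi s, y))| <= e / 2) y.
  - exact: topI.
  (* Both [h (s', y')] and [h (s', y)] are compared with [h (s, y)], hence half of [e / 2] for
     each. *)
  - move=> s _; have e40 : 0 < e / 4 by lra.
    have [d [V [d0 [oV [Vy H]]]]] := section_near y mh s e40.
    exists d, V; split; first exact/RltP.
    do 2!split=> //; move=> s' y' hs Vy'; move/RltP: hs; rewrite RabsE => hs.
    have := H s' y' hs Vy'; have := H s' y hs Vy.
    move: (phi _) (phi _) (phi _) => p q r; rewrite !ltr_norml ler_norml; lra.
  exists V; split=> //; split=> // y' Vy' _.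
  rewrite /avgK psiB abs_psi avgB; try exact: section_econt.
  apply: (@le_lt_trans _ _ (e / 2)); last by lra.
  rewrite -RabsE; apply/RleP; apply: avg_bound.
    have := section_econt y' mh; have := section_econt y mh.
    move=> /econtP c1 /econtP c2; apply/econtP => s d d0.
    have d20 : 0 < d / 2 by lra.
    have [d1 [d10 H1]] := c1 s _ d20; have [d2 [d20' H2]] := c2 s _ d20.
    exists (Num.min d1 d2); split; first by rewrite lt_min d10.
    move=> s'; rewrite lt_min => /andP[/H1 h1 /H2 h2].
    by move: h1 h2; rewrite !ltr_norml; lra.
  by move=> s hs; rewrite RabsE; apply/RleP; apply: HV.
(* For [s] in [[0,1]] the point [(psi s, y)] has size at most [max 1 R]. *)
move=> B R; case: mh => ch bh; have [M HM] := bh B (Num.max 1 R).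
exists M => y _ Ry; rewrite /= abs_psi -RabsE; apply/RleP; apply: avg_bound.
  exact: section_econt.
move=> s [/RleP s0 /RleP s1]; rewrite RabsE -absE; apply/RleP; apply: HM => //=.
by rewrite ge_max !le_max Ry orbT andbT abs_psi ger0_norm // s1.
Qed.

(** Differentiation under the integral sign as an algebraic identity: the quotient of the mean is
    the mean of the quotients of [h] in the direction [(0, w)] that [L] inserts. Only linearity of
    the mean enters, and no limits are interchanged even at [t = 0]. *)
Lemma isC_avgK k S (h : kcar (prodS scal S) -> kcar scal) : wfS abs S ->
  isC true k (prodS scal S) scal wholeset h -> isC true k S scal wholeset (avgK h).
Proof.
elim: k S h => [|k IH] S h wS ch.
  by split=> //; apply: mor_avgK => //; exact: isC_mor ch.
split; first by apply: mor_avgK => //; exact: isC_mor ch.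
have [mh [h1 [qh ch1]]] := ch.
have wK := scal_wf habs; have wT := tan_wf habs wS; have wP := prodS_wf habs wK wS.
have tS := wf_top wS; have tK := wf_top wK; have tT := wf_top wT; have tP := wf_top wP.
pose L (q : kcar (prodS scal (tan S))) : kcar (tan (prodS scal S)) :=
  (((q.1, q.2.1.1), (0, q.2.1.2)), q.2.2).
have tQ : is_topology (kop (prodS scal (tan S))) by exact: prod_op_topology.
have c2 : isC true k (prodS scal (tan S)) (tan S) wholeset snd by exact: isC_snd.
have cL : isC true k (prodS scal (tan S)) (tan (prodS scal S)) wholeset L.
  apply: isC_pair => //; last by apply: (isC_comp _ _ _ c2 (isC_par _ _ wholeset tS)).
  apply: isC_pair => //; apply: isC_pair => //.
  - exact: isC_fst.
  - by apply: (isC_comp _ _ _ c2 (isC_base _ _ wholeset tS)).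
  - exact: isC_cst.
  - by apply: (isC_comp _ _ _ c2 (isC_dir _ _ wholeset tS)).
have ch' : isC true k (prodS scal (tan S)) scal wholeset (h1 \o L).
  apply: (isC_comp _ _ _ cL ch1) => //.
  exact: (wf_top (tan_wf habs wP)).
exists (avgK (h1 \o L)); split; last by apply: (isC_sub (U := wholeset)) => //; apply: IH.
move=> [[y w] t] _ /=.
rewrite /avgK psiB avgB; try exact: section_econt.
rewrite /GRing.scale /=; apply: (can_inj phiK); rewrite phiM !psiK avgZ; last first.
  exact: (section_econt (S := tan S) ((y, w), t) (isC_mor ch')).
apply: avg_ext => s; rewrite -phiB -phiM /=; congr phi.
apply: etrans (qh (((psi s, y), (0, w)), t) (conj I I)); congr (h _ - _) => /=.
by congr pair; rewrite /= scaler0 addr0.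
Qed.

Definition liftK (f : RR -> RR) (t : K) : K := psi (f (phi t)).

Lemma derive_econt (f f' : RR -> RR) : (forall s, is_derive f s (f' s)) -> econt f.
Proof.
move=> H s e e0.
have := ex_derive_continuous f s (ex_intro _ _ (H s)).
move=> /(proj2 (continuity_pt_filterlim f s)) /(_ e e0) [d [d0 Hd]].
exists d; split=> // s' hs; case: (Req_dec s s') => [->|ne].
  by rewrite RminusE subrr RabsE normr0.
by apply: Hd; split.
Qed.

Lemma liftK_cont f : econt f -> cont_on (Kopen abs) (Kopen abs) wholeset (liftK f).
Proof.
move=> /econtP H; apply/(cont_onP habs) => x _ e e0; have [d [d0 Hd]] := H (phi x) e e0.
exists (fun y => abs (y - x) < d); split; first exact: Kball_open.
split=> [|y Hy _]; first by rewrite subrr (abs0 habs).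
by rewrite /liftK psiB abs_psi; apply: Hd; rewrite -phiB -absE.
Qed.

(** Hadamard's formula: [f (x + t v) - f x] is [t v] times the mean of [f' (x + s t v)] over [s] in
    [[0,1]]. So [v] times this mean is a quotient, also at [t = 0], and it inherits the class of
    [f']. *)
Lemma isC_of_derive k (f f' : RR -> RR) : (forall s, is_derive f s (f' s)) ->
  mor true scal scal wholeset (liftK f) -> isC true k scal scal wholeset (liftK f') ->
  isC true k.+1 scal scal wholeset (liftK f).
Proof.
move=> df mf cf'; split=> //.
have wK := scal_wf habs; have wT := tan_wf habs wK; have tK := wf_top wK; have tT := wf_top wT.
pose S := prodS scal (tan scal).
have tS : is_topology (kop S) by exact: prod_op_topology.
pose A (q : kcar S) : kcar scal := q.2.1.1 + (q.1 : K) * ((q.2.2 : K) * q.2.1.2).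
have c2 : isC true k S (tan scal) wholeset snd by exact: isC_snd.
have cA : isC true k S scal wholeset A.
  apply: isC_add => //; first by apply: (isC_comp _ _ _ c2 (isC_base _ _ wholeset tK)).
  apply: isC_mul => //; first exact: isC_fst.
  apply: isC_mul => //; first by apply: (isC_comp _ _ _ c2 (isC_par _ _ wholeset tK)).
  by apply: (isC_comp _ _ _ c2 (isC_dir _ _ wholeset tK)).
have cfA : isC true k S scal wholeset (liftK f' \o A) by apply: (isC_comp _ _ _ cA cf').
exists (fun p => (p.1.2 : K) * avgK (liftK f' \o A) p); split; last first.
  apply: (isC_sub (U := wholeset)) => //; apply: isC_mul => //; first exact: isC_dir.
  exact: isC_avgK.
move=> [[x v] t] _ /=; rewrite /GRing.scale /=.
apply: (can_inj phiK); rewrite phiB !phiM /liftK !psiK.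
rewrite mulrA -phiM avgZ; last exact: (section_econt (S := tan scal) ((x, v), t) (isC_mor cfA)).
rewrite (@avg_derive (fun s => f (phi x + s * phi (t * v))%R)) ?RminusE.
- by rewrite mul1r mul0r addr0 -phiD.
- have := section_econt (S := tan scal) ((x, v), t) (isC_mor cfA) => /econtP c; apply/econtP => s e e0.
  have M0 : 0 < 1 + `|phi (t * v)| by have := normr_ge0 (phi (t * v)); lra.
  have eM : 0 < e / (1 + `|phi (t * v)|) by rewrite divr_gt0.
  have [d [d0 Hd]] := c s _ eM; exists d; split=> // s' /Hd hs.
  rewrite -mulrBr normrM.
  move: hs; rewrite ltr_pdivlMr //; move: (`|_ - _|) (normr_ge0 (phi (t * v))).
  by move=> z n0; have := normr_ge0 (phi (t * v)); rewrite mulrDr mulr1 mulrC;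
     case: (leP 0 z) => z0; nra.
move=> s; rewrite /A /= psiK phiD (phiM (psi s)) psiK; set w := phi (t * v).
apply: (is_derive_comp f (fun s => Rplus (phi x) (Rmult s w))); first exact: df.
by auto_derive => //; rewrite RmultE mul1r.
Qed.

Lemma mor_flat m : mor true scal scal wholeset (liftK (flat m)).
Proof.
split; first by apply: liftK_cont; apply: derive_econt; exact: flat_derive.
move=> _ R; have [M HM] := flat_bound m; exists M => x _ _.
by rewrite /= /liftK abs_psi -RabsE; apply/RleP.
Qed.

Lemma isC_flat k m : isC true k scal scal wholeset (liftK (flat m)).
Proof.
have wK := scal_wf habs; have tK := wf_top wK.
elim: k m => [|k IH] m; first by split=> //; exact: mor_flat.
apply: (isC_of_derive (flat_derive m)); first exact: mor_flat.
apply: (@isC_ext _ _ _ _ scal scal _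
  (fun t => liftK (flat m.+2) t - psi (INR m) * liftK (flat m.+1) t)).
  by move=> t _; rewrite /liftK psiM psiB.
by apply: isC_subr => //; apply: isC_mul => //; exact: isC_cst.
Qed.

Lemma real_cutoff : exists chi : K -> K,
  (forall k, isC true k scal scal wholeset chi) /\ (forall t, abs (chi t) <= 1) /\
  (exists r : RR, 0 < r /\ forall t, abs t < r -> chi t = 1) /\
  (forall t, 1 <= abs t -> chi t = 0).
Proof.
have wK := scal_wf habs; have tK := wf_top wK.
pose q (t : K) : K := psi (Rinv (flat 0 (flat 0 1))) *
   liftK (flat 0) (psi (flat 0 1) - liftK (flat 0) t : K).
have qE t : q t = psi (smooth_step (phi t)).
  by rewrite /q /liftK psiB psiM psiK.
(* The square replaces the absolute value, which is not smooth: [4 t^2 - 1] is at most [0] for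
   [|t| <= 1/2] and at least [1] for [|t| >= 1]. *)
exists (fun t => q (psi 4%R * (t * t) - 1)).
have cq k : isC true k scal scal wholeset q.
  apply: isC_mul => //; first exact: isC_cst.
  apply: (isC_comp (T := scal) _ _ _ _ (isC_flat k 0)) => //.
  by apply: isC_subr => //; [exact: isC_cst|exact: isC_flat].
have aE t : phi (psi 4%R * (t * t) - 1) = 4 * abs t ^+ 2 - 1.
  by rewrite phiB phi1 !phiM psiK absE real_normK ?num_real // expr2.
split.
  move=> k; apply: (isC_comp (T := scal) _ _ _ _ (cq k)) => //.
  apply: isC_subr => //; last exact: isC_cst.
  by apply: isC_mul => //; [exact: isC_cst|apply: isC_mul => //; exact: isC_id].
split; first by move=> t; rewrite qE abs_psi -RabsE; apply/RleP; exact: smooth_step_bound.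
split.
  exists (1 / 2); split; first by lra.
  move=> t ht; rewrite qE aE smooth_step1.
    by apply: (can_inj phiK); rewrite psiK phi1.
  apply/RleP; change (4 * abs t ^+ 2 - 1 <= 0 :> RR).
  by have := abs_ge0 habs t; move: (abs t) ht => a ht a0; nra.
move=> t ht; rewrite qE aE smooth_step0.
  by apply: (can_inj phiK); rewrite psiK phi0.
apply/RleP; change (1 <= 4 * abs t ^+ 2 - 1 :> RR).
by move: (abs t) ht => a ht; nra.
Qed.

End RealCutoff.

Lemma cutoff_exists {K : fieldType} (abs : K -> RR) : abs_value abs ->
  ((nontrivial_abs abs /\ ultrametric abs) \/ real_valued abs) -> exists chi : K -> K,
  (forall k, isC abs true k (scal abs) (scal abs) wholeset chi) /\
  (forall t, abs (chi t) <= 1) /\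
  (exists r : RR, 0 < r /\ forall t, abs t < r -> chi t = 1) /\
  (forall t, 1 <= abs t -> chi t = 0).
Proof.
move=> habs [[_ hu]|[phi [[psi h1 h2] [hD [hM [h1' hn]]]]]]; last exact: (real_cutoff habs h1 h2).
exists (ball_ind (abs := abs)); split; first by move=> k; case: (isC_ball_outer habs hu k).
split; first by move=> t; rewrite /ball_ind; case: ifP; rewrite ?(abs0 habs) ?(abs1 habs).
split; first by exists 1; split=> // t ht; rewrite /ball_ind ht.
by move=> t; rewrite /ball_ind leNgt => /negPf ->.
Qed.

(** * Series with boundedly many non-zero terms at each point *)

Section Series.
Context {K : fieldType} {abs : K -> RR} (habs : abs_value abs) (hnt : nontrivial_abs abs).
Implicit Types (k : nat) (S T : sspace K).
Local Notation isC := (isC abs).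
Local Notation tan := (tan abs).
Local Notation wf := (wfS abs).
Local Notation scal := (scal abs).
Local Notation U1 := (U1 abs).

(* The bound is required of every continuous extension of the difference quotient;
   as this extension is unique, [M] can be chosen before any of them is. *)
Fixpoint Bd k (R M : RR) S (U : kcar S -> Prop) (f : kcar S -> kcar scal) : Prop :=
  (forall x, U x -> sz S x <= R -> abs (f x) <= M) /\
  match k with
  | 0 => True
  | k'.+1 => forall f1 : kcar (tan S) -> kcar scal,
      mor true (tan S) scal (U1 S U) f1 -> quot abs S scal U f f1 ->
      Bd k' R M (U1 S U : kcar (tan S) -> Prop) f1
  end.

Lemma scal_hausdorff : hausdorff (Kopen abs).
Proof.
move=> x y xy; have d0 : 0 < abs (x - y) / 2.
  by rewrite divr_gt0 // abs_gt0 // subr_eq0; apply/eqP.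
exists (fun z => abs (z - x) < abs (x - y) / 2), (fun z => abs (z - y) < abs (x - y) / 2).
split; first exact: Kball_open.
split; first exact: Kball_open.
rewrite !subrr (abs0 habs); split=> //; split=> // z; rewrite (absB habs z).
have := absD habs (x - z) (z - y); rewrite addrA subrK; lra.
Qed.

Lemma Bd_ext k R M S U (f g : kcar S -> kcar scal) :
  (forall x, U x -> f x = g x) -> Bd k R M U f -> Bd k R M U g.
Proof.
case: k => [|k] eq [bf H]; split=> //; try by move=> x Ux; rewrite -eq //; apply: bf.
move=> f1 m1 q1; apply: H => // p Up; rewrite !eq; first exact: q1.
  by case: Up.
by case: Up.
Qed.

Lemma Bd_mono k k' (R R' M M' : RR) S U (f : kcar S -> kcar scal) :
  (k' <= k)%N -> R' <= R -> M <= M' -> Bd k R M U f -> Bd k' R' M' U f.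
Proof.
move=> kk' RR' MM'; elim: k' k kk' S U f => [|k' IH] [|k] //= kk' S U f [bf H];
  split=> //; try by move=> x Ux Rx; rewrite (le_trans (bf x Ux (le_trans Rx RR'))).
by move=> f1 m1 q1; apply: (IH k) => //; apply: H.
Qed.

Lemma isC_Bd k S U (f : kcar S -> kcar scal) : wf S -> kop S U ->
  isC true k S scal U f -> forall R, exists M, Bd k R M U f.
Proof.
elim: k S U f => [|k IH] S U f wS oU [[cf bf] H] R; have [M HM] := bf isT R.
  by exists M.
have [f1 [q1 c1]] := H.
have [M1 HM1] := IH _ _ _ (tan_wf habs wS) (U1_open habs wS oU) c1 R.
exists (Num.max M M1); split; first by move=> x Ux Rx; rewrite le_max HM.
move=> g1 m1 qg; apply: (@Bd_mono k k R R M1) => //; first by rewrite le_max lexx orbT.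
apply: (Bd_ext _ HM1) => p Up.
rewrite (quot_dq (T := scal) habs hnt wS scal_hausdorff oU q1 (proj1 (isC_mor c1)) Up).
by rewrite (quot_dq (T := scal) habs hnt wS scal_hausdorff oU qg (proj1 m1) Up).
Qed.

Lemma Bd_scale k R M S U (f : kcar S -> kcar scal) (a : K) : wf S -> a != 0 ->
  Bd k R M U f -> Bd k R (abs a * M) U (fun x => a * (f x : K)).
Proof.
elim: k S U f => [|k IH] S U f wS a0 /= [bf H]; split=> //;
  try by move=> x Ux Rx; rewrite (absM habs) ler_wpM2l ?(abs_ge0 habs) ?bf.
(* [a^-1 * f1] is a quotient of [f], so its bound is known; multiplying back by [a] costs the factor
   [|a|]. *)
move=> f1 m1 q1; apply: (@Bd_ext _ _ _ (tan S) _ (fun p => a * (a^-1 * (f1 p : K)))).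
  by move=> p _; rewrite mulrA divff // mul1r.
have tT := wf_top (tan_wf habs wS).
apply: IH => //; first exact: tan_wf.
apply: H.
  apply: (isC_mor (k := 0)); apply: isC_mul => //; exact: isC_cst.
move=> p Up; have := q1 p Up; rewrite /GRing.scale /= => E.
by apply: (mulfI a0); rewrite mulrBr E mulrA [a * _]mulrC -mulrA (mulrA a) divff // mul1r.
Qed.

(** Duplicate-free lists express that at most [N] indices matter at a point, without presupposing
    that there are finitely many. *)
Definition supp_le S (U : kcar S -> Prop) (kap : nat -> kcar S -> K) (N : nat) : Prop :=
  forall x, U x -> forall s : seq nat, uniq s -> all (fun n => kap n x != 0) s -> (size s <= N)%N.

Definition vanish_from (X : Type) (kap : nat -> X -> K) (x : X) (m : nat) : Prop :=
  forall n, (m <= n)%N -> kap n x = 0.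

(** The number of terms depends on the point. The default [0] is never reached on a set where
    [supp_le] holds. *)
Definition psum (X : Type) T (kap : nat -> X -> K) (z : nat -> kcar T) (x : X) : kcar T :=
  match pselect (exists m, vanish_from kap x m) with
  | left h => \sum_(0 <= n < sval (cid h)) kap n x *: z n
  | right _ => 0
  end.

Lemma vanish_from_mono X (kap : nat -> X -> K) x m m' :
  (m <= m')%N -> vanish_from kap x m -> vanish_from kap x m'.
Proof. by move=> mm' H n mn; apply: H; exact: leq_trans mn. Qed.

Lemma sum_vanish X T (kap : nat -> X -> K) (z : nat -> kcar T) x m m' :
  (m <= m')%N -> vanish_from kap x m ->
  \sum_(0 <= n < m') kap n x *: z n = \sum_(0 <= n < m) kap n x *: z n.
Proof.
move=> mm' H; rewrite (big_cat_nat (leq0n m) mm') /= [X in _ + X]big_nat_cond.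
rewrite [X in _ + X]big1 ?addr0 // => n /andP[/andP[mn _] _].
by rewrite H // scale0r.
Qed.

Lemma psumE X T (kap : nat -> X -> K) (z : nat -> kcar T) x m :
  vanish_from kap x m -> psum kap z x = \sum_(0 <= n < m) kap n x *: z n.
Proof.
move=> H; rewrite /psum; case: pselect => [h|[]]; last by exists m.
case: cid => m' /= H'; case: (leqP m m') => mm'; first by rewrite (sum_vanish _ mm').
by rewrite (sum_vanish _ (ltnW mm')).
Qed.

Lemma psum_single X T (kap : nat -> X -> K) (z : nat -> kcar T) x n0 :
  (forall n, n != n0 -> kap n x = 0) -> psum kap z x = kap n0 x *: z n0.
Proof.
move=> H; rewrite (@psumE _ _ _ _ _ n0.+1); last first.
  by move=> n hn; apply: H; rewrite gtn_eqF.
rewrite big_nat_recr //= big_nat_cond big1 ?add0r // => n /andP[/andP[_ hn] _].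
by rewrite H ?scale0r // ltn_eqF.
Qed.

Lemma supp_vanish S U (kap : nat -> kcar S -> K) N x :
  supp_le U kap N -> U x -> exists m, vanish_from kap x m.
Proof.
move=> sN Ux; apply: contrapT => H.
have H' m : exists n, (m <= n)%N /\ kap n x != 0.
  apply: contrapT => C; apply: H; exists m => n mn; apply/eqP; apply: contrapT => C'.
  by apply: C; exists n; split=> //; apply/negP.
have [s [us [as_ [ss _]]]] : exists s : seq nat, uniq s /\ all (fun n => kap n x != 0) s /\
    size s = N.+1 /\ exists b, all (fun n => n < b)%N s.
  elim: N.+1 => [|j [s [us [as_ [ss [b hb]]]]]]; first by exists [::]; do 3!split=> //; exists 0%N.
  have [n [bn kn]] := H' b; exists (n :: s); split.
    rewrite /= us andbT; apply/negP => ns; have := allP hb n ns; by rewrite ltnNge bn.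
  split; first by rewrite /= kn.
  split; first by rewrite /= ss.
  exists n.+1; rewrite /= ltnSn; apply: sub_all hb => i hi.
  by rewrite ltnS ltnW // (leq_trans hi).
by have := sN x Ux s us as_; rewrite ss ltnn.
Qed.

(** Continuity of scaling at [(0, 0)] handles only scalars below some [d]; shrinking the
    neighbourhood by a factor [a] with [|a| < d] extends this to the closed unit ball. *)
Lemma balanced T W : wf T -> kop T W -> W 0 -> exists V, kop T V /\ V 0 /\
  forall (s : K) v, abs s <= 1 -> V v -> W (s *: v).
Proof.
move=> wT oW W0; have tT := wf_top wT.
have [|A [oA [A0 HA]]] := wf_scale wT (0, 0) I W oW; first by rewrite scaler0.
have [B [C [oB [oC [/= B0 [C0 HBC]]]]]] := oA _ A0.
have [d [d0 Hd]] := oB _ B0.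
have [a a0 ad] := small_scalar habs hnt d0.
exists (fun v => C (a^-1 *: v)); split.
  apply: (isC_open (abs := abs) (b := false) (k := 0) tT _ oC).
  by apply: isC_Zl => //; exact: isC_id.
split; first by rewrite scaler0.
move=> s v s1 Cv; have -> : s *: v = (s * a) *: (a^-1 *: v).
  by rewrite scalerA mulrK // unitfE.
apply: (HA (s * a, a^-1 *: v)) => //; apply: HBC => //=; apply: Hd.
by rewrite subr0 (absM habs) (le_lt_trans _ ad) // ler_piMl ?(abs_ge0 habs).
Qed.

(** A substitute for convexity: continuity of addition at [(0, 0)] is applied [N] times. This is why
    the number of non-zero terms must be bounded independently of the point. *)
Lemma small_sums T W N : wf T -> kop T W -> W 0 -> exists V, kop T V /\ V 0 /\
  forall (I : Type) (F : I -> kcar T) (s : seq I), (size s <= N)%N ->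
    (forall i, V (F i)) -> W (\sum_(i <- s) F i).
Proof.
move=> wT; elim: N W => [|N IH] W oW W0.
  by exists W; do 2!split=> //; move=> I F [|//] _ _; rewrite big_nil.
have [|A [oA [A0 HA]]] := wf_add wT (0, 0) I W oW; first by rewrite addr0.
have [B [C [oB [oC [/= B0 [C0 HBC]]]]]] := oA _ A0.
have [V [oV [V0 HV]]] := IH C oC C0.
have [_ [_ topI]] := wf_top wT.
exists (fun v => B v /\ V v); split; first exact: topI.
split=> // J F [|i s] hs HF; first by rewrite big_nil.
rewrite big_cons; apply: (HA (F i, _)) => //; apply: HBC => /=; first by case: (HF i).
by apply: HV => // j; case: (HF j).
Qed.

(** For [t] non-zero, a quotient is non-zero only if its function is so at one of the two end
    points, whence [N + N]. For [t = 0], finitely many continuous functions that do not vanish at a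
    point do not vanish nearby either, so [t] can be moved to a small non-zero value. *)
Lemma supp_le_deriv S U (kap : nat -> kcar S -> kcar scal)
    (kap1 : nat -> kcar (tan S) -> kcar scal) N : wf S -> kop S U ->
  (forall n, quot abs S scal U (kap n) (kap1 n)) ->
  (forall n, cont_on (kop (tan S)) (kop scal) (U1 S U) (kap1 n)) ->
  supp_le U kap N -> supp_le (U1 S U : kcar (tan S) -> Prop) kap1 (N + N).
Proof.
move=> wS oU q1 c1 sN.
have main p s : U1 S U p -> (p.2 : K) != 0 -> uniq s -> all (fun n => kap1 n p != 0) s ->
    (size s <= N + N)%N.
  move=> Up p0 us as_.
  pose P n := kap n p.1.1 != 0.
  rewrite -(count_predC P s) leq_add //.
    rewrite -size_filter; apply: (sN p.1.1); first by case: Up.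
      exact: filter_uniq.
    exact: filter_all.
  rewrite -size_filter; apply: (sN (p.1.1 + (p.2 : K) *: p.1.2)); first by case: Up.
    exact: filter_uniq.
  apply/allP => n; rewrite mem_filter => /andP[/negbNE /eqP e ns].
  have := allP as_ n ns; apply: contraNneq => e'.
  have := q1 n p Up; rewrite e e' subrr => /esym/eqP.
  by rewrite /GRing.scale /= mulf_eq0 (negPf p0).
move=> [[x v] t] Up s us as_; have [t0|t0] := eqVneq (t : K) 0; last exact: main Up t0 us as_.
rewrite t0 in Up as_.
have [d [d0 Hd]] : exists d : RR, 0 < d /\ forall t : K, abs t < d ->
    U (x + t *: v) -> all (fun n => kap1 n ((x, v), t) != 0) s.
  elim: s as_ {us} => [|n s IH] /=; first by exists 1.
  move=> /andP[kn /IH [d [d0 Hd]]].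
  have [V [oV [Vp HV]]] := c1 n _ Up _ (neq0_open habs) kn.
  have [A [B [oA [oB [/= Ax [B0 HAB]]]]]] := oV _ Vp.
  have [d' [d0' Hd']] := oB _ B0.
  exists (Num.min d d'); split; first by rewrite lt_min d0.
  move=> t'; rewrite lt_min => /andP[td td'] Ut; rewrite Hd // andbT.
  apply: HV; last by split=> //; case: Up.
  by apply: HAB => //=; apply: Hd'; rewrite subr0.
have [e [e0 He]] := open_line habs v wS oU (proj1 Up : U x).
have [|a a0] := small_scalar habs hnt (e := Num.min d e); first by rewrite lt_min d0.
rewrite lt_min => /andP[ad ae].
apply: (main ((x, v), a)) => //; first by split; [case: Up|exact: He].
by apply: Hd => //; exact: He.
Qed.

Lemma isC_sum b k S T U (I : Type) (F : I -> kcar S -> kcar T) (s : seq I) :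
  is_topology (kop S) -> wf T -> (forall i, isC b k S T U (F i)) ->
  isC b k S T U (fun x => \sum_(i <- s) F i x).
Proof.
move=> tS wT H; elim: s => [|i s IH].
  apply: (@isC_ext _ _ _ _ _ _ _ (fun _ => 0)); first by move=> x _; rewrite big_nil.
  exact: isC_cst.
apply: (@isC_ext _ _ _ _ _ _ _ (fun x => F i x + \sum_(j <- s) F j x)).
  by move=> x _; rewrite big_cons.
exact: isC_add.
Qed.

Lemma cont_psum S T U (kap : nat -> kcar S -> kcar scal) (z : nat -> kcar T) N :
  wf S -> wf T -> supp_le U kap N ->
  (forall n, cont_on (kop S) (kop scal) U (kap n)) ->
  (forall R : RR, exists n0, forall n x, (n0 <= n)%N -> U x -> sz S x <= R -> abs (kap n x) <= 1) ->
  (forall W, kop T W -> W 0 -> exists n0, forall n, (n0 <= n)%N -> W (z n)) ->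
  cont_on (kop S) (kop T) U (psum kap z).
Proof.
move=> wS wT sN ck bk z0 x Ux W oW Wx.
have tS := wf_top wS; have [_ [_ topI]] := tS.
have [|A [oA [A0 HA]]] := wf_add wT (psum kap z x, 0) I W oW; first by rewrite addr0.
have [B [C [oB [oC [/= B0 [C0 HBC]]]]]] := oA _ A0.
have [C1 [oC1 [C10 HC1]]] := small_sums N wT oC C0.
have [C2 [oC2 [C20 HC2]]] := balanced wT oC1 C10.
have [n1 Hn1] := z0 C2 oC2 C20.
have [V [R [oV [Vx HV]]]] := sz_locb wS x.
have [n2 Hn2] := bk R.
have [n3 Hn3] := supp_vanish sN Ux.
(* Beyond [n1] the vectors [z n] are small, beyond [n2] the coefficients are at most [1] near [x],
   and beyond [n3] the terms vanish at [x]. The head up to [n0] is a continuous finite sum and the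
   tail is uniformly small. *)
pose n0 := maxn n1 (maxn n2 n3).
have cF : isC false 0 S T U (fun y => \sum_(n <- index_iota 0 n0) (kap n y : K) *: z n).
  apply: isC_sum => // n.
  have cn : isC false 0 S scal U (kap n) by split=> //; split=> //; exact: ck.
  exact: (isC_smul habs tS wT cn (isC_cst _ _ _ (z n) tS)).
have [|D [oD [Dx HD]]] := (proj1 (isC_mor cF)) x Ux B oB.
  rewrite -(@psumE _ _ kap z x n0) //; apply: vanish_from_mono Hn3.
  by rewrite /n0 !leq_max leqnn !orbT.
exists (fun y => D y /\ V y); split; first exact: topI.
split=> // y [Dy Vy] Uy.
have [m Hm] := supp_vanish sN Uy.
have Hm' : vanish_from kap y (maxn n0 m) by apply: vanish_from_mono Hm; rewrite leq_maxr.
rewrite (psumE _ Hm') (@big_cat_nat _ _ _ n0) ?leq_maxl //=.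
apply: (HA (_, _)) => //; apply: HBC => /=; first exact: HD.
rewrite (bigID (fun n => kap n y != 0)) /= [X in _ + X]big1 ?addr0; last first.
  by move=> n /negbNE /eqP ->; rewrite scale0r.
rewrite -big_filter.
set s := [seq n <- _ | _].
have ss : forall n, n \in s -> C1 (kap n y *: z n).
  move=> n; rewrite mem_filter mem_index_iota => /andP[_ /andP[hn _]].
  apply: HC2; last by apply: Hn1; apply: leq_trans hn; rewrite leq_maxl.
  apply: Hn2 => //; last exact: HV.
  by apply: leq_trans hn; rewrite /n0 leq_max leq_max leqnn orbT.
(* [small_sums] wants every member of the family in the neighbourhood, so terms off the list are
   replaced by [0]. *)
have -> : \sum_(n <- s) kap n y *: z n = \sum_(n <- s) (if n \in s then kap n y *: z n else 0).
  by rewrite !big_seq; apply: eq_bigr => n ->.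
apply: HC1; last by move=> n; case: ifP => [/ss|].
apply: (sN y Uy); first by rewrite filter_uniq // iota_uniq.
exact: filter_all.
Qed.

(** The quotients of the coefficients, with the same vectors [z n], form a series of the same kind
    with doubled support bound. That its sum is the quotient of the sum is finite algebra, once a
    length [m] common to all three sums is chosen. *)
Lemma isC_psum k S T U (kap : nat -> kcar S -> kcar scal) (z : nat -> kcar T) N :
  wf S -> kop S U -> wf T -> supp_le U kap N ->
  (forall n, isC true k S scal U (kap n)) ->
  (forall R : RR, exists n0, forall n, (n0 <= n)%N -> Bd k R 1 U (kap n)) ->
  (forall W, kop T W -> W 0 -> exists n0, forall n, (n0 <= n)%N -> W (z n)) ->
  isC false k S T U (psum kap z).
Proof.
elim: k S U kap N => [|k IH] S U kap N wS oU wT sN ck bk z0.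
  split=> //; split=> //; apply: cont_psum sN _ _ z0 => //.
    by move=> n; case: (isC_mor (ck n)).
  by move=> R; have [n0 H] := bk R; exists n0 => n x /H [h _]; apply: h.
split.
  split=> //; apply: cont_psum sN _ _ z0 => //.
    by move=> n; case: (isC_mor (ck n)).
  by move=> R; have [n0 H] := bk R; exists n0 => n x /H [h _]; apply: h.
have [kap1 H1] := boolp.choice (fun n => proj2 (ck n)).
have s1 : supp_le (U1 S U : kcar (tan S) -> Prop) kap1 (N + N).
  apply: (supp_le_deriv wS oU _ _ sN) => n; first by case: (H1 n).
  by case: (isC_mor (proj2 (H1 n))).
exists (psum kap1 z); split; last first.
  apply: (IH (tan S) _ kap1 (N + N)%N) => //.
  - exact: tan_wf.
  - exact: U1_open.
  - by move=> n; case: (H1 n).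
  - move=> R; have [n0 H] := bk R; exists n0 => n /H [_ h]; apply: h; last by case: (H1 n).
    exact: isC_mor (proj2 (H1 n)).
move=> p Up.
have [m1 h1] := supp_vanish sN (proj1 Up : U _).
have [m2 h2] := supp_vanish sN (proj2 Up : U _).
have [m3 h3] := supp_vanish s1 Up.
pose m := maxn m1 (maxn m2 m3).
rewrite (@psumE _ _ _ _ _ m); last by apply: vanish_from_mono h2; rewrite /m !leq_max leqnn !orbT.
rewrite (@psumE _ _ _ _ p.1.1 m); last by apply: vanish_from_mono h1; rewrite /m !leq_max leqnn.
rewrite (@psumE _ _ _ _ p m); last by apply: vanish_from_mono h3; rewrite /m !leq_max leqnn !orbT.
rewrite -sumrB scaler_sumr; apply: eq_bigr => n _.
by rewrite -scalerBl (proj1 (H1 n) p Up) scalerA.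
Qed.

End Series.

(** * Continuity along smooth curves *)

(** Each neighbourhood of [0] contains all but finitely many [B n], so any choice of points in [B n]
    tends to [0] although the [B n] need not decrease. *)
Definition first_countable0 {K : fieldType} (S : kspace K) : Prop :=
  exists B : nat -> kcar S -> Prop, (forall n, kop S (B n) /\ B n 0) /\
    forall W, kop S W -> W 0 -> exists n0, forall n x, (n0 <= n)%N -> B n x -> W x.

Section Curve.
Context {K : fieldType} {abs : K -> RR} (habs : abs_value abs) (hnt : nontrivial_abs abs).
Local Notation isC := (isC abs).
Local Notation wf := (wfS abs).
Local Notation scal := (scal abs).
Context (chi : K -> K) (chiC : forall k, isC true k scal scal wholeset chi)
  (chi_le1 : forall t, abs (chi t) <= 1)
  (chi_near : exists r : RR, 0 < r /\ forall t, abs t < r -> chi t = 1)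
  (chi_far : forall t, 1 <= abs t -> chi t = 0).

Lemma chi0 : chi 0 = 1.
Proof. by have [r [r0 H]] := chi_near; apply: H; rewrite (abs0 habs). Qed.

Lemma large_scalar (M : RR) : exists2 a : K, a != 0 & M <= abs a.
Proof.
have [|a a0 Ha] := @small_scalar _ _ habs hnt (`|M| + 1)^-1%R.
  by rewrite invr_gt0; have := normr_ge0 M; lra.
exists a^-1; rewrite ?invr_eq0 // (absV habs).
have aa := abs_gt0 habs a0.
have : `|M| + 1 < (abs a)^-1.
  by rewrite -[ltLHS]invrK ltf_pV2 // posrE invr_gt0; have := normr_ge0 M; lra.
have := ler_norm M; lra.
Qed.

(* The bumps sit at [a ^+ n]; [1/|a| >= 3] makes their supports disjoint. *)
Definition bump (a : K) (n : nat) (t : K) : K := chi (a^-1 * (t * a ^- n - 1)).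

Section Bumps.
Context (a : K) (a0 : a != 0) (a3 : abs a <= 1 / 3).

Lemma isC_bump k n : isC true k scal scal wholeset (bump a n).
Proof.
have wK := scal_wf habs; have tK := wf_top wK.
have cf : isC true k scal scal wholeset (fun t : K => a^-1 * (t * a ^- n - 1)).
  apply: isC_mul => //; first exact: isC_cst.
  apply: isC_subr => //; last exact: isC_cst.
  by apply: isC_mul => //; [exact: isC_id|exact: isC_cst].
exact: (isC_comp tK tK _ cf (chiC k)).
Qed.

Lemma bump_center n : bump a n (a ^+ n) = 1.
Proof. by rewrite /bump divff ?expf_neq0 // subrr mulr0 chi0. Qed.

(** Non-vanishing means [|t a^-n - 1| < |a| <= 1/3], which places [|t| / |a|^n] between [2/3] and
    [4/3]. Since [4/3 * 1/3 < 2/3], these ranges are disjoint for distinct [n]. *)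
Lemma bump_neq0 n t : bump a n t != 0 ->
  abs a ^+ n * (2 / 3) < abs t /\ abs t < abs a ^+ n * (4 / 3).
Proof.
have aa := abs_gt0 habs a0; have an : 0 < abs a ^+ n by rewrite exprn_gt0.
move=> H; have : abs (t * a ^- n - 1) < 1 / 3.
  have : abs (a^-1 * (t * a ^- n - 1)) < 1.
    by rewrite ltNge; apply: contraNN H => /chi_far; rewrite /bump => ->.
  rewrite (absM habs) (absV habs) mulrC ltr_pdivrMr // => h.
  by rewrite mul1r in h; exact: lt_le_trans h a3.
have := absD habs (t * a ^- n - 1) 1; rewrite subrK (abs1 habs).
have := absD habs (1 - t * a ^- n) (t * a ^- n); rewrite subrK (abs1 habs).
rewrite (absB habs 1); move: (abs (t * a ^- n - 1)) => d h1 h2 hd.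
have e : abs t = abs a ^+ n * abs (t * a ^- n).
  by rewrite -(absX habs) -(absM habs) mulrC mulfVK // expf_neq0.
by rewrite e !ltr_pM2l //; split; lra.
Qed.

Lemma bump_disjoint n m t : bump a n t != 0 -> bump a m t != 0 -> n = m.
Proof.
have aa := abs_gt0 habs a0.
have a3l := a3.
have lt i j : (i < j)%N -> bump a i t != 0 -> bump a j t != 0 -> False.
  move=> ij /bump_neq0 [h1 _] /bump_neq0 [_ h2].
  have : abs a ^+ j <= abs a ^+ i.+1 by apply: ler_wiXn2l => //; lra.
  have ai : 0 < abs a ^+ i by rewrite exprn_gt0.
  rewrite exprS; move: h1 h2 ai; move: (abs a ^+ i) (abs a ^+ j) (abs t) => p q r.
  by nra.
case: (ltngtP n m) => // h; [move/(lt _ _ h)=> C /C //|].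
by move=> H1 H2; case: (lt _ _ h H2 H1).
Qed.

Lemma bump_at0 n : bump a n 0 = 0.
Proof.
apply/eqP; apply: contraT => /bump_neq0 [h _]; move: h; rewrite (abs0 habs) ltNge mulr_ge0 //.
  by rewrite exprn_ge0 // (abs_ge0 habs).
by lra.
Qed.

End Bumps.

Lemma curve_continuous (E F : sspace K) (U : kcar E -> Prop) (f : kcar E -> kcar F) :
  wf E -> first_countable0 E -> kop E U ->
  (forall c : kcar scal -> kcar E, (forall k, isC false k scal E wholeset c) ->
     (forall t, U (c t)) -> cont_on (kop scal) (kop F) wholeset (f \o c)) ->
  cont_on (kop E) (kop F) U f.
Proof.
move=> wE [B [HB1 HB2]] oU Hc x Ux W oW Wx; apply: contrapT => HV.
have far V : kop E V -> V x -> exists y, [/\ V y, U y & ~ W (f y)].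
  move=> oV Vx; apply: contrapT => C; apply: HV; exists V; do 2!split=> //.
  by move=> y Vy Uy; apply: contrapT => Wy; apply: C; exists y.
have wK := scal_wf habs; have tE := wf_top wE; have [_ [_ topI]] := tE.
have [|a a0 a3'] := @small_scalar _ _ habs hnt (1 / 3)%R; first by lra.
have a3 := ltW a3'.
(* A diagonal choice: the [n]-th bump is bounded to order [n] on size [n], so for any fixed order
   and size all but finitely many bumps are controlled. *)
have HM n := isC_Bd habs hnt wK (proj1 (wf_top wK)) (isC_bump a n n) n%:R.
have [M {}HM] := boolp.choice HM.
have HD n : exists d : K, d != 0 /\ M n <= abs d.
  by have [d d0 hd] := large_scalar (M n); exists d.
have [D {}HD] := boolp.choice HD.
(* The factor [D n] moves from the bump to its vector: the coefficients then obey bounds by [1], and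
   the vectors [D n *: (y n - x)] have to be made small. *)
pose kap n t := (D n)^-1 * bump a n t.
have trC : isC false 0 E E wholeset (fun v => x + v).
  by apply: isC_add => //; [exact: isC_cst|exact: isC_id].
have oUx : kop E (fun v => U (x + v)) by exact: (isC_open tE trC oU).
have [|V1 [oV1 [V10 HV1]]] := balanced habs hnt wE oUx; first by rewrite addr0.
(* The condition on [V1] keeps the curve inside [U], since a bump value of size at most [1] only
   rescales [y - x]. The condition on [B n] makes the rescaled vectors tend to [0]. *)
have Hy n : exists y, [/\ V1 (y - x), B n (D n *: (y - x)) & ~ W (f y)].
  have [oB B0] := HB1 n.
  have trC' : isC false 0 E E wholeset (fun v => v - x).
    by apply: isC_subr => //; [exact: isC_id|exact: isC_cst].
  have [||y [[h1 h2] _ h3]] := far (fun y => V1 (y - x) /\ B n (D n *: (y - x))).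
  - apply: topI; first exact: (isC_open tE trC' oV1).
    exact: (isC_open tE (isC_Zl habs (D n) tE wE trC') oB).
  - by rewrite subrr scaler0.
  - by exists y.
have [y {}Hy] := boolp.choice Hy.
pose z n := D n *: (y n - x).
pose c t := x + psum kap z t.
have kap0 n t : (kap n t != 0) = (bump a n t != 0).
  by rewrite mulf_eq0 invr_eq0 (negPf (proj1 (HD n))).
have single n t : kap n t != 0 -> psum kap z t = bump a n t *: (y n - x).
  move=> h; rewrite (@psum_single _ _ _ _ _ _ n); last first.
    move=> m; apply: contraNeq; rewrite kap0 => h'; rewrite kap0 in h.
    by rewrite (bump_disjoint a0 a3 h h').
  by rewrite /kap /z scalerA mulrAC mulVf ?mul1r //; case: (HD n).
have single0 t : (forall n, kap n t = 0) -> psum kap z t = 0.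
  by move=> h; rewrite (@psum_single _ _ _ _ _ _ 0) ?h ?scale0r.
have cU t : U (c t).
  rewrite /c; case: (pselect (exists n, kap n t != 0)) => [[n h]|h].
    rewrite (single n) //; apply: HV1; first exact: chi_le1.
    by case: (Hy n).
  rewrite single0 ?addr0 // => n; apply/eqP; apply: contrapT => C.
  by apply: h; exists n; apply/negP.
have c0 : c 0 = x.
  by rewrite /c single0 ?addr0 // => n; rewrite /kap bump_at0 // mulr0.
have ca n : c (a ^+ n) = y n.
  rewrite /c (single n); first by rewrite bump_center // scale1r addrC subrK.
  by rewrite kap0 bump_center // oner_neq0.
have cC k : isC false k scal E wholeset c.
  apply: isC_add => //; [exact: (wf_top wK)|exact: (isC_cst _ _ _ _ (wf_top wK))|].
  apply: (@isC_psum _ _ habs hnt k scal E wholeset kap z 1) => //.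
  - exact: (proj1 (wf_top wK)).
  - move=> t _ [|n [|m s]] //= /andP[ns _] /and3P[]; rewrite !kap0 => h1 h2 _.
    by move: ns; rewrite inE (bump_disjoint a0 a3 h1 h2) eqxx.
  - move=> n; apply: isC_mul => //; [exact: (wf_top wK)|exact: (isC_cst _ _ _ _ (wf_top wK))|].
    exact: isC_bump.
  - move=> R; exists (maxn k (Num.bound (Num.max 0 R))) => n; rewrite geq_max => /andP[kn Rn].
    have [d0 hd] := HD n.
    apply: (@Bd_mono _ _ n k n%:R%R R (abs (D n)^-1 * M n)%R) => //.
    + have : 0 <= Num.max 0 R by rewrite le_max lexx.
      move=> /archi_boundP h; have : R <= Num.max 0 R by rewrite le_max lexx orbT.
      move=> h'; rewrite (le_trans h') // (le_trans (ltW h)) // ler_nat //.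
    + by rewrite (absV habs) mulrC ler_pdivrMr ?mul1r // (abs_gt0 habs).
    + by apply: Bd_scale => //; rewrite invr_eq0.
  - move=> V oV V0; have [n0 Hn0] := HB2 V oV V0; exists n0 => n hn.
    by apply: (Hn0 n) => //; case: (Hy n).
have [|V [oV [V0 HV']]] := Hc c cC cU 0 I W oW; first by rewrite /= c0.
have [e [e0 He]] := oV 0 V0.
have [n Hn] : exists n, abs a ^+ n < e.
  by apply: expr_small => //; [exact: abs_gt0|lra].
case: (Hy n) => _ _; apply; rewrite -ca; apply: (HV' (a ^+ n)) => //.
by apply: He; rewrite subr0 (absX habs).
Qed.

End Curve.

(** * Comparison with the definition by iterated difference quotients *)

Section Tower.
Context {K : fieldType} (abs : K -> RR) (F : kspace K).

(** Hiding the space in a dependent triple allows quotients to be peeled off at the inner end too: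
    [spk abs (sp1 abs S) k] and [spk abs S k.+1] are equal but not convertible for variable [k]. *)
Definition fdata := {S : kspace K & ((kcar S -> Prop) * (kcar S -> kcar F))%type}.
Definition mkfd (S : kspace K) (U : kcar S -> Prop) (f : kcar S -> kcar F) : fdata :=
  existT _ S (U, f).

Definition step (y w : fdata) : Prop :=
  let: existT X (U, f) := y in
  exists h, w = mkfd (S := sp1 abs X) (U1 abs X U) h /\
    cont_on (kop X) (kop F) U f /\ diff1 abs X F U f h.

Fixpoint steps k (y w : fdata) : Prop :=
  match k with
  | 0 => y = w
  | k'.+1 => exists v, steps k' y v /\ step v w
  end.

Lemma steps_left k y w : steps k.+1 y w <-> exists v, step y v /\ steps k v w.
Proof.
elim: k w => [|k IH] w.
  by split=> [[v [-> H]]|[v [H <-]]]; [exists w|exists y].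
split=> [[v [/IH [u [yu uv]] vw]]|[u [yu [v [uv vw]]]]].
  by exists u; split=> //; exists v.
by exists v; split=> //; apply/IH; exists u.
Qed.

Lemma Ck_steps S U k (f : kcar S -> kcar F) :
  Ck abs S F U k f <-> cont_on (kop S) (kop F) U f /\ exists w, steps k (mkfd U f) w.
Proof.
split=> [[h]|[cf [w]]].
  have : is_fk abs S F U k f h -> cont_on (kop S) (kop F) U f /\
      steps k (mkfd U f) (@mkfd (spk abs S k) (Uk abs S U k) h).
    elim: k h => [|k IH] h /=; first by move=> [-> cf].
    move=> [g [/IH [cf sg] [cg dg]]]; split=> //.
    by exists (@mkfd (spk abs S k) (Uk abs S U k) g); split=> //; exists h.
  by move=> H /H [cf st]; split=> //; eexists; exact: st.
suff : steps k (mkfd U f) w -> exists h, w = @mkfd (spk abs S k) (Uk abs S U k) h /\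
    is_fk abs S F U k f h by move=> H /H [h [_ fh]]; exists h.
elim: k w => [|k IH] w /=; first by move=> <-; exists f.
move=> [v [/IH [g [-> fg]] [h [-> [cg dg]]]]]; exists h; split=> //.
by exists g.
Qed.

Lemma Ck_S S U k (f : kcar S -> kcar F) :
  Ck abs S F U k.+1 f <-> cont_on (kop S) (kop F) U f /\
    exists f1, quot abs S F U f f1 /\ Ck abs (sp1 abs S) F (U1 abs S U) k f1.
Proof.
split=> [/Ck_steps [cf [w /steps_left [v [[f1 [-> [_ [c1 q1]]]] st]]]]|[cf [f1 [q1 /Ck_steps [c1 [w st]]]]]].
  by split=> //; exists f1; split=> //; apply/Ck_steps; split=> //; exists w.
apply/Ck_steps; split=> //; exists w; apply/steps_left.
by exists (@mkfd (sp1 abs S) (U1 abs S U) f1); split=> //; exists f1.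
Qed.

End Tower.

Lemma isC_Ck {K : fieldType} (abs : K -> RR) k (S F : sspace K) U (f : kcar S -> kcar F) :
  isC abs false k S F U f <-> Ck abs S F U k f.
Proof.
elim: k S U f => [|k IH] S U f.
  by split=> [[[cf _] _]|[g [_ cf]]]; [exists f|split].
split=> [[[cf _] [f1 [q1 c1]]]|/Ck_S [cf [f1 [q1 c1]]]].
  by apply/Ck_S; split=> //; exists f1; split=> //; exact: (proj1 (IH (tan abs S) _ _) c1).
split=> //; exists f1; split=> //; exact: (proj2 (IH (tan abs S) _ _) c1).
Qed.

(** * Coordinate spaces *)

Section Coordinates.
Context {K : fieldType} {abs : K -> RR} (habs : abs_value abs).
Local Notation isC := (isC abs).
Local Notation wf := (wfS abs).
Local Notation scal := (scal abs).

(** The zero size meets all the inequalities required, so any topological vector space enters the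
    calculus; it serves with flag [false], where no bounds are recorded. *)
Definition plainS (S : kspace K) : sspace K := SSpace S (fun _ => 0).
Definition KN n : sspace K := plainS (Kn abs n).

Lemma finite_inter (X : Type) (opX : (X -> Prop) -> Prop) (I : finType) (A : I -> X -> Prop) x :
  is_topology opX -> (forall i, exists V, opX V /\ V x /\ forall y, V y -> A i y) ->
  exists V, opX V /\ V x /\ forall y, V y -> forall i, A i y.
Proof.
move=> [tT [_ topI]] H.
suff [V [oV [Vx HV]]] : exists V, opX V /\ V x /\ forall y, V y -> forall i, i \in enum I -> A i y.
  by exists V; do 2!split=> //; move=> y Vy i; apply: HV => //; rewrite mem_enum.
elim: (enum I) => [|i s [V [oV [Vx HV]]]]; first by exists (fun _ => True).
have [W [oW [Wx HW]]] := H i.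
exists (fun y => W y /\ V y); split; first exact: topI.
split=> // y [Wy Vy] j; rewrite inE => /predU1P[->|js]; [exact: HW|exact: HV].
Qed.

Lemma Kn_topology n : is_topology (kop (KN n)).
Proof.
split; first by move=> x _; exists 1.
split.
  move=> I A oA x [i /oA [e [e0 H]]]; exists e; split=> // y Hy.
  by exists i; apply: H.
move=> A B oA oB x [/oA [e [e0 H]] /oB [e' [e0' H']]].
exists (Num.min e e'); split; first by rewrite lt_min e0.
by move=> y Hy; split; [apply: H|apply: H'] => i; have := Hy i; rewrite lt_min => /andP[].
Qed.

Lemma cont_coord n D i : cont_on (kop (KN n)) (Kopen abs) D (fun p : 'rV[K]_n => p ord0 i).
Proof.
move=> p _ W oW Wp; exists (fun q : 'rV[K]_n => W (q ord0 i)); split; last by split.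
by move=> q /oW [e [e0 He]]; exists e; split=> // q' Hq; apply: He.
Qed.

Lemma cont_of_coord (X : Type) (opX : (X -> Prop) -> Prop) n D (f : X -> 'rV[K]_n) :
  is_topology opX -> (forall i, cont_on opX (Kopen abs) D (fun x => f x ord0 i)) ->
  cont_on opX (kop (KN n)) D f.
Proof.
move=> tX H x Dx W oW /oW [e [e0 He]].
have [|V [oV [Vx HV]]] := @finite_inter X opX 'I_n
    (fun i y => D y -> abs (f y ord0 i - f x ord0 i) < e) x tX.
  move=> i; have [V [oV [Vx HV]]] := proj1 (cont_onP habs _ _ _) (H i) x Dx e e0.
  by exists V.
by exists V; do 2!split=> //; move=> y Vy Dy; apply: He => i; apply: HV.
Qed.

Lemma KN_wf n : wf (KN n).
Proof.
have tX := Kn_topology n; have wK := scal_wf habs; have tK := wf_top wK.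
split=> //=; try by move=> *; rewrite ?addr0 ?mulr0.
- apply: cont_of_coord; first exact: prod_op_topology.
  move=> i; apply: (@cont_on_ext _ _ _ _ _
    ((fun p : K * K => p.1 + p.2) \o (fun p : 'rV[K]_n * 'rV[K]_n => (p.1 ord0 i, p.2 ord0 i)))).
    by move=> p _; rewrite mxE.
  apply: (cont_on_comp (D' := wholeset) (opY := prod_op (Kopen abs) (Kopen abs))) (wf_add wK) => //.
  apply: cont_on_pair; first exact: prod_op_topology.
    apply: (@cont_on_comp _ _ _ _ (kop (KN n)) _ _ wholeset fst (fun p : 'rV[K]_n => p ord0 i)) => //.
      exact: cont_on_fst.
    exact: cont_coord.
  apply: (@cont_on_comp _ _ _ _ (kop (KN n)) _ _ wholeset snd (fun p : 'rV[K]_n => p ord0 i)) => //.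
    exact: cont_on_snd.
  exact: cont_coord.
- apply: cont_of_coord; first exact: prod_op_topology.
  move=> i; apply: (@cont_on_ext _ _ _ _ _
    ((fun p : K * K^o => p.1 *: p.2) \o (fun p : K * 'rV[K]_n => (p.1, p.2 ord0 i)))).
    by move=> p _; rewrite mxE.
  apply: (cont_on_comp (D' := wholeset) (opY := prod_op (Kopen abs) (Kopen abs))) (wf_scale wK) => //.
  apply: cont_on_pair; first exact: prod_op_topology.
    exact: cont_on_fst.
  apply: (@cont_on_comp _ _ _ _ (kop (KN n)) _ _ wholeset snd (fun p : 'rV[K]_n => p ord0 i)) => //.
    exact: cont_on_snd.
  exact: cont_coord.
- by move=> x; exists (fun _ => True), 0; split; [case: tX|].
Qed.

Lemma isC_coord k n U i : isC false k (KN n) scal U (fun p : 'rV[K]_n => p ord0 i).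
Proof.
apply: isC_lin => /=; first exact: Kn_topology.
- by move=> x y; rewrite mxE.
- by move=> a x; rewrite mxE.
- by split=> //; exact: cont_coord.
Qed.

Lemma isC_of_coord k (S : sspace K) n U (f : kcar S -> kcar (KN n)) : is_topology (kop S) ->
  (forall i, isC false k S scal U (fun x => (f x : 'rV[K]_n) ord0 i)) ->
  isC false k S (KN n) U f.
Proof.
move=> tS H; have wN := KN_wf n.
apply: (@isC_ext _ _ _ _ _ (KN n) _ (fun x =>
    \sum_(i <- index_enum 'I_n) ((f x : 'rV[K]_n) ord0 i : K) *: (delta_mx ord0 i : 'rV[K]_n))).
  by move=> x _; rewrite -row_sum_delta.
apply: isC_sum => // i; apply: (isC_smul habs tS wN (H i)).
exact: isC_cst.
Qed.

End Coordinates.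

(** * Lowering the order by one difference quotient *)

Section Induction.
Context {K : fieldType} {abs : K -> RR} (habs : abs_value abs) (hnt : nontrivial_abs abs).
Local Notation isC := (isC abs).
Local Notation wf := (wfS abs).
Local Notation scal := (scal abs).
Local Notation tan := (tan abs).
Local Notation U1 := (U1 abs).
Local Notation KN := (KN (abs := abs)).
Context (chi : K -> K) (chiC : forall k, isC true k scal scal wholeset chi)
  (chi_le1 : forall t, abs (chi t) <= 1)
  (chi_near : exists r : RR, 0 < r /\ forall t, abs t < r -> chi t = 1)
  (chi_far : forall t, 1 <= abs t -> chi t = 0).

(** [t * chi (t / r)] is the identity near [0] and vanishes once [|t| >= |r|], so it never leaves
    the ball of radius [e]. It turns local substitutions into global ones. *)
Lemma retraction (e : RR) : 0 < e -> exists rho : K -> K,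
  [/\ forall k, isC false k scal scal wholeset rho, forall t, abs (rho t) < e &
      exists d : RR, 0 < d /\ forall t, abs t < d -> rho t = t].
Proof.
move=> e0; have [r r0 re] := small_scalar habs hnt e0.
have wK := scal_wf habs; have tK := wf_top wK; have ar := abs_gt0 habs r0.
exists (fun t => t * chi (t * r^-1)); split.
- move=> k; apply: isC_mul => //; first exact: isC_id.
  have cr : isC false k scal scal wholeset (fun t : K => t * r^-1).
    by apply: isC_mul => //; [exact: isC_id|exact: isC_cst].
  exact: (isC_comp tK tK _ cr (isC_forget (chiC k))).
- move=> t; case: (leP 1 (abs (t * r^-1))) => h; first by rewrite chi_far // mulr0 (abs0 habs).
  move: h; rewrite (absM habs) (absV habs) ltr_pdivrMr // mul1r => h.
  rewrite (absM habs) (le_lt_trans _ re) // (le_trans _ (ltW h)) //.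
  by rewrite ler_piMr ?(abs_ge0 habs).
- have [d [d0 Hd]] := chi_near; exists (d * abs r); split; first by rewrite mulr_gt0.
  by move=> t ht; rewrite Hd ?mulr1 // (absM habs) (absV habs) ltr_pdivrMr.
Qed.

Definition along_curves k (E F : sspace K) (U : kcar E -> Prop) (f : kcar E -> kcar F) : Prop :=
  forall c : kcar (KN k.+1) -> kcar E, (forall j, isC false j (KN k.+1) E wholeset c) ->
    (forall x, U (c x)) -> isC false k (KN k.+1) F wholeset (f \o c).

Definition tail_coord n (w : 'rV[K]_(1 + n)) : 'rV[K]_n := rsubmx w.
Definition head_coord n (w : 'rV[K]_(1 + n)) : K := w ord0 ord0.
Definition join_coord n (t : K) (s : 'rV[K]_n) : 'rV[K]_(1 + n) := row_mx t%:M s.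

Lemma tail_join n t (s : 'rV[K]_n) : tail_coord (join_coord t s) = s.
Proof. exact: row_mxKr. Qed.

Lemma head_join n t (s : 'rV[K]_n) : head_coord (join_coord t s) = t.
Proof.
rewrite /head_coord /join_coord; have -> : ord0 = lshift n (ord0 : 'I_1) by exact: val_inj.
by rewrite (row_mxEl t%:M) mxE eqxx mulr1n.
Qed.

Lemma join_shift n (s : 'rV[K]_n) t : join_coord 0 s + t *: join_coord 1 0 = join_coord t s.
Proof.
by rewrite /join_coord scale_row_mx add_row_mx scaler0 addr0 scale_scalar_mx mulr1 raddf0 add0r.
Qed.

Lemma isC_tail k n : isC false k (KN n.+1) (KN n) wholeset (@tail_coord n).
Proof.
apply: isC_of_coord => //; first exact: Kn_topology.
move=> i; apply: (@isC_ext _ _ _ _ (KN n.+1) scal _ (fun w : 'rV[K]_(1 + n) => w ord0 (rshift 1 i))).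
  by move=> w _; rewrite /tail_coord mxE.
exact: (@isC_coord _ _ k n.+1).
Qed.

Lemma isC_head k n : isC false k (KN n.+1) scal wholeset (@head_coord n).
Proof. exact: (@isC_coord _ _ k n.+1). Qed.

Lemma isC_join k n t : isC false k (KN n) (KN n.+1) wholeset (@join_coord n t).
Proof.
have tN := Kn_topology (abs := abs) n.
apply: (isC_of_coord habs (n := n.+1)) => // j; case: (split_ordP (j : 'I_(1 + n))) => i ->.
  apply: (@isC_ext _ _ _ _ (KN n) scal _ (fun _ => t%:M ord0 i)).
    by move=> s _; rewrite /join_coord (row_mxEl t%:M).
  exact: isC_cst.
apply: (@isC_ext _ _ _ _ (KN n) scal _ (fun s : 'rV[K]_n => s ord0 i)).
  by move=> s _; rewrite /join_coord (row_mxEr t%:M).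
exact: isC_coord.
Qed.

(** A dummy variable is added to [c] to meet the hypothesis in [k + 2] variables, and is then set to
    [0]. *)
Lemma along_curves_S k (E F : sspace K) U (f : kcar E -> kcar F) : along_curves k.+1 U f ->
  forall c : kcar (KN k.+1) -> kcar E, (forall j, isC false j (KN k.+1) E wholeset c) ->
    (forall x, U (c x)) -> isC false k.+1 (KN k.+1) F wholeset (f \o c).
Proof.
move=> Hf c cc cU.
have tN := Kn_topology (abs := abs) k.+1; have tN' := Kn_topology (abs := abs) k.+2.
have H := Hf (c \o @tail_coord k.+1) (fun j => isC_comp tN' tN (fun _ _ => I) (isC_tail j _) (cc j))
  (fun x => cU _).
apply: (isC_ext _ (isC_comp tN tN' (fun _ _ => I) (isC_join k.+1 _ 0) H)).
by move=> s _ /=; rewrite tail_join.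
Qed.

(** A curve becomes a test map by reading only the first coordinate; composing with the diagonal
    recovers it. *)
Lemma along_curves_cont k (E F : sspace K) U (f : kcar E -> kcar F) :
  wf E -> first_countable0 E -> kop E U -> along_curves k U f -> cont_on (kop E) (kop F) U f.
Proof.
move=> wE fE oU Hf; apply: (curve_continuous habs hnt chiC) => // c cc cU.
have tN := Kn_topology (abs := abs) k.+1; have tK := wf_top (scal_wf habs).
have c0 j : isC false j (KN k.+1) scal wholeset (fun p : 'rV[K]_k.+1 => p ord0 ord0).
  exact: isC_coord.
have H := Hf (c \o (fun p : 'rV[K]_k.+1 => p ord0 ord0))
  (fun j => isC_comp tN tK (fun _ _ => I) (c0 j) (cc j)) (fun x => cU _).
have cd : isC false k scal (KN k.+1) wholeset (fun t : K => \row_(i < k.+1) t).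
  apply: isC_of_coord => // i; apply: (@isC_ext _ _ _ _ scal scal _ id); last exact: isC_id.
  by move=> t _; rewrite mxE.
have := proj1 (isC_mor (isC_comp tK tN (fun _ _ => I) cd H)).
by apply: cont_on_ext => t _ /=; rewrite mxE.
Qed.

Lemma along_curves_dq k (E F : sspace K) (U : kcar E -> Prop) (f : kcar E -> kcar F) :
  wf E -> wf F -> hausdorff (kop F) -> kop E U -> along_curves k.+1 U f ->
  along_curves k (E := tan E) (U1 E U) (dq (abs := abs) f).
Proof.
move=> wE wF hF oU Hf g cg gU.
have wN := KN_wf habs k.+1; have tN := wf_top wN; have tN' := Kn_topology (abs := abs) k.+2.
have tE := wf_top wE; have tTE := wf_top (tan_wf habs wE).
have wK := scal_wf habs; have tK := wf_top wK.
pose X s := (g s).1.1; pose V s := (g s).1.2; pose T s : K := (g s).2.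
have cX j : isC false j (KN k.+1) E wholeset X.
  exact: (isC_comp tN tTE (fun _ _ => I) (cg j) (isC_base _ _ wholeset tE)).
have cV j : isC false j (KN k.+1) E wholeset V.
  exact: (isC_comp tN tTE (fun _ _ => I) (cg j) (isC_dir _ _ wholeset tE)).
have cT j : isC false j (KN k.+1) scal wholeset T.
  exact: (isC_comp tN tTE (fun _ _ => I) (cg j) (isC_par _ _ wholeset tE)).
have gE s : g s = ((X s, V s), T s) by rewrite /X /V /T; case: (g s) => [[]].
apply: isC_local => //; first by case: tN.
move=> s0 _; have [T0|T0] := eqVneq (T s0) 0; last first.
  exists (fun s => T s != 0); split; first exact: (isC_open tN (cT 0%N) (neq0_open habs)).
  split=> //.
  apply: (@isC_ext _ _ _ _ _ _ _ (fun s => (T s)^-1 *: (f (X s + T s *: V s) - f (X s)))).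
    by move=> s [_ h]; rewrite /= gE /dq /= (negPf h).
  apply: isC_smul => //.
    apply: isC_inv => //; first by move=> s [].
    by apply: (isC_sub _ (cT k)).
  apply: (@isC_sub _ _ _ _ _ _ wholeset) => //; apply: isC_S.
  apply: isC_subr => //.
    apply: (along_curves_S Hf (c := fun s => X s + T s *: V s)); last by move=> s; case: (gU s).
    by move=> j; apply: isC_add => //; apply: isC_smul.
  by apply: (along_curves_S Hf (c := X)) => // s; case: (gU s).
pose A (q : kcar (prodS (KN k.+1) scal)) := X q.1 + (q.2 : K) *: V q.1.
have tP : is_topology (kop (prodS (KN k.+1) scal)) by exact: prod_op_topology.
have cA : isC false 0 (prodS (KN k.+1) scal) E wholeset A.
  have c1 := isC_fst (abs := abs) false 0 (S := KN k.+1) (T := scal) wholeset tN tK.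
  apply: isC_add => //; first exact: (isC_comp tP tN (fun _ _ => I) c1 (cX _)).
  apply: isC_smul => //; first exact: isC_snd.
  exact: (isC_comp tP tN (fun _ _ => I) c1 (cV _)).
(* A box around [(s0, 0)] on which [X s + tau V s] stays in [U]. The retraction is chosen to keep
   both cut-off parameters in it. *)
have [|O1 [O2 [oO1 [oO2 [O10 [O20 HO]]]]]] := isC_open tP cA oU (s0, 0).
  by rewrite /A /= scale0r addr0; case: (gU s0).
have [e1 [e10 He1]] := oO1 _ O10; have [e2 [e20 He2]] := oO2 _ O20.
have [|rho [cr br [d [d0 Hd]]]] := @retraction (Num.min e1 e2); first by rewrite lt_min e10.
(* Coordinatewise retraction centred at [s0]: the identity near [s0], with all values in [O1]. *)
pose sg (s : 'rV[K]_k.+1) : 'rV[K]_k.+1 := \row_i (s0 ord0 i + rho (s ord0 i - s0 ord0 i)).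
have csg j : isC false j (KN k.+1) (KN k.+1) wholeset sg.
  apply: isC_of_coord => // i.
  apply: (@isC_ext _ _ _ _ (KN k.+1) scal _
      (fun s : 'rV[K]_k.+1 => s0 ord0 i + rho (s ord0 i - s0 ord0 i))).
    by move=> s _; rewrite mxE.
  apply: isC_add => //; first exact: isC_cst.
  have cs : isC false j (KN k.+1) scal wholeset (fun s : 'rV[K]_k.+1 => s ord0 i - s0 ord0 i).
    by apply: isC_subr => //; [exact: isC_coord|exact: isC_cst].
  exact: (isC_comp tN tK (fun _ _ => I) cs (cr j)).
pose c (w : kcar (KN k.+2)) := X (sg (tail_coord w)) + rho (head_coord w) *: V (sg (tail_coord w)).
have cc j : isC false j (KN k.+2) E wholeset c.
  have c1 : isC false j (KN k.+2) (KN k.+1) wholeset (sg \o @tail_coord k.+1).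
    exact: (isC_comp tN' tN (fun _ _ => I) (isC_tail j _) (csg j)).
  apply: isC_add => //; first exact: (isC_comp tN' tN (fun _ _ => I) c1 (cX j)).
  apply: isC_smul => //; last exact: (isC_comp tN' tN (fun _ _ => I) c1 (cV j)).
  exact: (isC_comp tN' tK (fun _ _ => I) (isC_head j _) (cr j)).
have cU w : U (c w).
  apply: (HO (sg (tail_coord w), rho (head_coord w))) => /=.
    apply: He1 => i; rewrite mxE addrC addKr.
    by apply: lt_le_trans (br _) _; rewrite ge_min lexx.
  apply: He2; rewrite subr0.
  by apply: lt_le_trans (br _) _; rewrite ge_min lexx orbT.
have ch := Hf c cc cU; have [mh [h1 [qh ch1]]] := ch.
have [|O3 [oO3 [O30 HO3]]] := @finite_inter _ (kop (KN k.+1)) 'I_k.+1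
    (fun i (s : 'rV[K]_k.+1) => abs (s ord0 i - s0 ord0 i) < d) s0 tN.
  move=> i; exists (fun s : 'rV[K]_k.+1 => abs (s ord0 i - s0 ord0 i) < d).
  split; last by rewrite subrr (abs0 habs).
  have ci : isC false 0 (KN k.+1) scal wholeset (fun p : 'rV[K]_k.+1 => p ord0 i).
    exact: isC_coord.
  exact: (isC_open (T := scal) tN ci (@Kball_open _ _ habs (s0 ord0 i) d)).
have hE s t : O3 s -> abs t < d -> f (c (join_coord 0 s + t *: join_coord 1 0)) = f (X s + t *: V s).
  move=> Os ht; rewrite /c join_shift tail_join head_join Hd //.
  have -> // : sg s = s.
  by apply/rowP => i; rewrite mxE Hd ?(HO3 s Os) // addrC subrK.
have hE0 s : O3 s -> f (c (join_coord 0 s)) = f (X s).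
  by move=> Os; have := hE s 0 Os; rewrite !scale0r !addr0 (abs0 habs) => ->.
exists (fun s => O3 s /\ abs (T s) < d); split.
  have [_ [_ topI]] := tN; apply: topI => //.
  have := isC_open tN (cT 0%N) (@Kball_open _ _ habs 0 d).
  by congr (kop _ _); apply/funext => s; rewrite subr0.
split; first by rewrite T0 (abs0 habs).
(* Base [(0, s)], direction [(1, 0)], parameter [T s]: a move along the extra variable of [c]
   reproduces the increment [T s *: V s]. *)
have cj : isC false k (KN k.+1) (tan (KN k.+2)) wholeset
    (fun s => ((join_coord 0 s, join_coord 1 0), T s)).
  by apply: isC_pair => //; apply: isC_pair => //; [exact: isC_join|exact: isC_cst].
have tT2 := wf_top (tan_wf habs (KN_wf habs k.+2)).
have c1 : isC false k (KN k.+1) F wholeset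
    (h1 \o (fun s => ((join_coord 0 s, join_coord 1 0), T s))).
  by apply: (isC_comp tN tT2 _ cj ch1) => s _; split.
apply: (@isC_ext _ _ _ _ (KN k.+1) _ _ _ _ _ (isC_sub _ c1)) => //.
move=> s [_ [Os Ts]] /=; rewrite gE.
have [Tz|Tn] := eqVneq (T s) 0.
  (* Here [dq f] is a directional derivative not yet known to exist. By [hE], the increments of [f]
     along [V s] and those of [f \o c] along the extra variable agree for small [t], and the latter
     have the limit [h1]. *)
  rewrite Tz; symmetry; apply: (dq_isD habs hnt hF) => W oW Ww.
  have oT : kop (KN k.+2) wholeset by case: tN'.
  have [d' [d0' Hd']] := @quot_isD _ _ habs (KN k.+2) F wholeset (f \o c) h1
    (join_coord 0 s) (join_coord 1 0) (KN_wf habs k.+2) oT qh (proj1 (isC_mor ch1)) I W oW Ww.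
  exists (Num.min d d'); split; first by rewrite lt_min d0.
  move=> t t0; rewrite lt_min => /andP[td td'].
  by have := Hd' t t0 td'; rewrite /= hE // hE0.
rewrite /dq /= (negPf Tn).
have := qh ((join_coord 0 s, join_coord 1 0), T s) (conj I I); rewrite /= hE // hE0 // => ->.
by rewrite scalerA mulVf // scale1r.
Qed.

Lemma prod_first_countable (S T : sspace K) :
  first_countable0 S -> first_countable0 T -> first_countable0 (prodS S T).
Proof.
move=> [A [HA1 HA2]] [B [HB1 HB2]]; exists (fun n p => A n p.1 /\ B n p.2); split.
  move=> n; have [oA A0] := HA1 n; have [oB B0] := HB1 n; split=> //.
  by move=> p [Ap Bp]; exists (A n), (B n).
move=> W oW W0; have [C [D [oC [oD [C0 [D0 HCD]]]]]] := oW _ W0.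
have [n1 H1] := HA2 C oC C0; have [n2 H2] := HB2 D oD D0.
exists (maxn n1 n2) => n x; rewrite geq_max => /andP[h1 h2] [Ax Bx].
by apply: HCD; [apply: (H1 n)|apply: (H2 n)].
Qed.

Lemma inv_small (e : RR) : 0 < e -> exists n0, forall n, (n0 <= n)%N -> n.+1%:R^-1 < e.
Proof.
move=> e0; exists (Num.bound e^-1) => n hn.
have : 0 <= e^-1 by rewrite invr_ge0 ltW.
move=> /archi_boundP h.
rewrite -[ltRHS]invrK ltf_pV2 ?posrE ?invr_gt0 ?ltr0n //.
by apply: (lt_le_trans h); rewrite ler_nat; apply: leqW.
Qed.

Lemma scal_first_countable : first_countable0 scal.
Proof.
exists (fun n t => abs (t - 0) < n.+1%:R^-1); split.
  move=> n; split; first exact: Kball_open.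
  by rewrite subrr (abs0 habs) invr_gt0 ltr0n.
move=> W oW /oW [e [e0 He]]; have [n0 Hn0] := inv_small e0.
by exists n0 => n t /Hn0 h ht; apply: He; exact: lt_trans h.
Qed.

(** The induction replaces [E] by [tan E], so the countability assumption is carried in the form
    [first_countable0], which passes to products. *)
Lemma along_curves_isC k (E F : sspace K) (U : kcar E -> Prop) (f : kcar E -> kcar F) :
  wf E -> first_countable0 E -> wf F -> hausdorff (kop F) -> kop E U ->
  along_curves k U f -> isC false k E F U f.
Proof.
move=> wE fE wF hF; elim: k E U f wE fE => [|k IH] E U f wE fE oU Hf.
  by split=> //; split=> //; exact: along_curves_cont Hf.
split; first by split=> //; exact: along_curves_cont Hf.
exists (dq f); split; first exact: dq_quot.
apply: (IH (tan E)).
- exact: tan_wf.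
- by do 2?apply: prod_first_countable => //; exact: scal_first_countable.
- exact: U1_open.
- exact: along_curves_dq.
Qed.

End Induction.

(** * From metrizable topological vector spaces to the final equivalence *)

Lemma plainS_wf {K : fieldType} (abs : K -> RR) (S : kspace K) :
  is_tvs abs S -> wfS abs (plainS S).
Proof.
move=> [tS [_ [aS sS]]]; split=> //=; try by move=> *; rewrite ?addr0 ?mulr0.
by move=> x; exists (fun _ => True), 0; split=> //; case: tS.
Qed.

Lemma metrizable_first_countable {K : fieldType} (S : kspace K) :
  metrizable S -> first_countable0 S.
Proof.
move=> [d [d_ge0 [d_eq0 [d_sym [d_tri H]]]]].
exists (fun n x => d 0 x < n.+1%:R^-1); split.
  move=> n; split; last by rewrite (proj2 (d_eq0 0 0)) // invr_gt0 ltr0n.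
  apply/H => x hx; exists (n.+1%:R^-1 - d 0 x); split; first by rewrite subr_gt0.
  by move=> y hy; have := d_tri 0 x y; move: hy; move: (n.+1%:R^-1) => e; lra.
move=> W /H oW /oW [e [e0 He]]; have [n0 Hn0] := inv_small e0.
by exists n0 => n x /Hn0 h hx; apply: He; exact: lt_trans h.
Qed.

Lemma real_valued_nontrivial {K : fieldType} (abs : K -> RR) :
  real_valued abs -> nontrivial_abs abs.
Proof.
move=> [phi [[psi h1 h2] [_ [_ [_ hn]]]]]; exists (psi 2).
by rewrite hn h2 normr_nat; split; lra.
Qed.

Theorem theorem12p4 (K : fieldType) (abs : K -> RR) :
  abs_value abs ->
  ((nontrivial_abs abs /\ ultrametric abs) \/ real_valued abs) ->
  forall (E F : kspace K), is_tvs abs E -> is_tvs abs F -> metrizable E ->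
  forall (U : kcar E -> Prop), kop E U -> (exists x, U x) ->
  forall f : kcar E -> kcar F,
    (forall k : nat,
       Ck abs E F U k f <->
       (forall c : kcar (Kn abs k.+1) -> kcar E,
          smooth abs (Kn abs k.+1) E (fun _ => True) c -> (forall x, U (c x)) ->
          Ck abs (Kn abs k.+1) F (fun _ => True) k (f \o c)))
    /\
    (smooth abs E F U f <->
       (forall k : nat, (0 < k)%N ->
          forall c : kcar (Kn abs k) -> kcar E,
            smooth abs (Kn abs k) E (fun _ => True) c -> (forall x, U (c x)) ->
            smooth abs (Kn abs k) F (fun _ => True) (f \o c))).
Proof.
move=> habs hK E F tE tF mE U oU _ f.
have hnt : nontrivial_abs abs by case: hK => [[]|/real_valued_nontrivial].
have [chi [chiC [chi1 [chin chif]]]] := cutoff_exists habs hK.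
have wE := plainS_wf tE; have wF := plainS_wf tF.
have fE : first_countable0 (plainS E) by exact: metrizable_first_countable.
have hF : hausdorff (kop (plainS F)) by case: tF => _ [].
have fwd k n (c : kcar (Kn abs n) -> kcar E) : Ck abs E F U k f ->
    Ck abs (Kn abs n) E (fun _ => True) k c -> (forall x, U (c x)) ->
    Ck abs (Kn abs n) F (fun _ => True) k (f \o c).
  move=> /(proj2 (@isC_Ck _ abs k (plainS E) (plainS F) U f)) cf.
  move=> /(proj2 (@isC_Ck _ abs k (KN n) (plainS E) _ c)) cc cU.
  apply/(@isC_Ck _ abs k (KN n) (plainS F)).
  by apply: (isC_comp _ _ _ cc cf) => //; [exact: Kn_topology|exact: wf_top wE].
have bwd k : (forall c : kcar (Kn abs k.+1) -> kcar E,
      smooth abs (Kn abs k.+1) E (fun _ => True) c -> (forall x, U (c x)) ->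
      Ck abs (Kn abs k.+1) F (fun _ => True) k (f \o c)) -> Ck abs E F U k f.
  move=> H; apply/(@isC_Ck _ abs k (plainS E) (plainS F)).
  apply: (along_curves_isC habs hnt chiC) => // c cc cU.
  apply/(@isC_Ck _ abs k (KN k.+1) (plainS F)); apply: H => // j.
  exact/(@isC_Ck _ abs j (KN k.+1) (plainS E)).
split=> [k|]; first by split=> [cf c cc cU|]; [exact: fwd|exact: bwd].
(* Order and number of variables are independent here, so class [C^k] is tested with [k + 1]
   variables. *)
split=> [cf k _ c cc cU j|H k]; first exact: fwd.
by apply: bwd => c cc cU; apply: H.
Qed.
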